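(* Let $0<q<1$ and let $$K(x;t)=\frac{1}{1+x}\,x^t\Big(1+\frac1x\Big)_q^t(1+x)_q^{1-t}.$$ Then the following hold. (a) In the limits $q\to1$ and $q\to0$ one has $$\lim_{q\to1}K(x;t)=1\quad\text{for all }x,t\in\mathbb R,$$ $$\lim_{q\to0}K(x;t)=x^t+x^{t-1}\quad\text{for all }t\in(0,1),\ x\in\mathbb R.$$ In particular, for $t\in(0,1)$, $K(x;t)$ is not constant in $x$. (b) Viewed as a function of $t$, $K(x;t)$ satisfies the recurrence relation $$K(x;t+1)=q^tK(x;t).$$ Since $K(x;0)=K(x;1)=1$, one has in particular, for any positive integer $n$, $$K(x;n)=q^{n(n-1)/2}.$$ (c) As a function of $x$, $K(x;t)$ is a ''$q$-constant'', namely $$D_qK(x;t)=0\quad\text{for all }t,x\in\mathbb R.$$ In other words, $K(q^nx;t)=K(x;t)$ for every integer $n$.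
   Context: Notation, for $0<q<1$: $(1+a)_q^\infty=\prod_{j=0}^\infty(1+q^ja)$ and, for $t\in\mathbb C$, $(1+a)_q^t=\dfrac{(1+a)_q^\infty}{(1+q^ta)_q^\infty}$. The $q$-derivative of a function $f$ of $x$ is $(D_qf)(x)=\dfrac{f(qx)-f(x)}{(q-1)x}$. The function $K(x;t)$ depends on $q$ through these symbols; $q$ is fixed in $(0,1)$ except where a limit in $q$ is taken.
   Formalization: In (a) the limit q→1 is claimed for x>0 with all real t, and for x<0, x≠-1 only with integer t (for x<0 and non-integer t it fails, since K=0 whenever x=-q^k); throughout, x and t are such that no denominator of K vanishes (so x≠0,-1). *)

(* Defs.v *)
From mathcomp Require Import all_boot all_order all_algebra complex.
From mathcomp Require Import all_classical all_reals all_analysis.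
Set Implicit Arguments.
Unset Strict Implicit.
Unset Printing Implicit Defensive.
Import Order.TTheory GRing.Theory Num.Theory numFieldNormedType.Exports.
Local Open Scope classical_set_scope.
Local Open Scope ring_scope.
Local Open Scope complex_scope.

(* The topology on the complex numbers is that of the normed module R[i]^o
   (R[i] itself carries no canonical topology), hence the ^o annotations.   *)

Definition cexp (R : realType) (z : R[i]) : R[i] :=
  (expR (complex.Re z))%:C * (cos (complex.Im z) +i* sin (complex.Im z)).

(* Principal logarithm of a nonzero real number: ln x for 0 < x and
   ln (- x) + i pi for x < 0.                                               *)
Definition clog (R : realType) (x : R) : R[i] :=
  ln `|x| +i* (if x < 0 then pi else 0).

(* x^t for a nonzero real x and a complex exponent t (junk value at x = 0).  *)
Definition cpow (R : realType) (x : R) (t : R[i]) : R[i] :=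
  cexp (t * clog x).

(* (1 + a)_q^oo *)
Definition qinfty (R : realType) (q : R) (a : R[i]) : R[i] :=
  limn (fun n : nat => \prod_(j < n) (1 + (q ^+ j)%:C * a) : R[i]^o).

(* (1 + a)_q^t *)
Definition qpow (R : realType) (q : R) (a t : R[i]) : R[i] :=
  qinfty q a / qinfty q (cpow q t * a).

Definition K (R : realType) (q x : R) (t : R[i]) : R[i]^o :=
  1 / (1 + x%:C) * cpow x t * qpow q (1 / x%:C) t * qpow q x%:C (1 - t).

(* Division is total in MathComp; this says that no denominator occurring in
   the formula for K q x t vanishes. For 0 < q < 1 the last two conditions
   exclude exactly the x of the form - q^(t + k) with k an integer, so the
   predicate holds for all x > 0 and all real t.                            *)
Definition K_defined (R : realType) (q x : R) (t : R[i]) : Prop :=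
  [/\ x != 0, 1 + x%:C != 0 :> R[i],
      qinfty q (cpow q t * (1 / x%:C)) != 0
    & qinfty q (cpow q (1 - t) * x%:C) != 0].

Definition Dq (R : realType) (q : R) (f : R -> R[i]) (x : R) : R[i] :=
  (f (q * x) - f x) / ((q - 1) * x)%:C.

(* Main.v *)
Require Import Defs.
From mathcomp Require Import all_boot all_order all_algebra complex.
From mathcomp Require Import all_classical all_reals all_analysis.
From mathcomp Require Import ring lra zify.
Set Implicit Arguments.
Unset Strict Implicit.
Unset Printing Implicit Defensive.
Import Order.TTheory GRing.Theory Num.Theory numFieldNormedType.Exports.
Local Open Scope classical_set_scope.
Local Open Scope ring_scope.
Local Open Scope complex_scope.
Import ComplexField.Normc.

(* Write P(a) for (1 + a)_q^oo and theta(x) = P(x) P(q / x). Parts (b) and (c)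
   follow from P(a) = (1 + a) P(q a), and for q -> 0 all factors of K but
   1 + x and 1 + 1/x tend to 1. For q -> 1, x > 0 and 0 <= t <= 1, the
   log-convexity of s |-> P(q^s a) (a Bohr-Mollerup argument) gives
     (1 + a)^s <= P(a) / P(q^s a) <= (1 + q^(s - 1) a)^s,
   which squeezes K; the other values of t are reached by the recurrence.
   For the non-constancy at a fixed q = e^(-2h), the Jacobi triple product turns
   K(x; t) into a constant times W(v) / W(v - s), with s = 1 - t,
   x = e^(h (2v - 1)) and W_h(v) = sum_n e^(-h (n - v)^2). If K is constant in x
   then this ratio is constant, with value 1 because W is even (v = s/2), so W_h
   has period s. The duplication formula
     W_h(p + v) W_h(p - v)
       = W_2h(p) W_2h(v) + W_2h(p - 1/2) W_2h(v - 1/2)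
   shows that W_2h has period s or 1/2, and so has W_(2^n h) for all n. But
   W_H(0) >= 1 while W_H(r) -> 0 as H -> oo for 0 < r < 1. *)

(** * Limits in the complex plane *)

Section Complex.
Variable R : realType.
Implicit Types (q x t s a : R) (z w : R[i]).

Lemma normCE z : `|z| = (normc z)%:C.
Proof. by []. Qed.

Lemma normc_real x : normc x%:C = `|x|.
Proof. by rewrite /= expr0n addr0 sqrtr_sqr. Qed.

Lemma normc_ge0 z : 0 <= normc z.
Proof. by case: z => ? ?; rewrite /= sqrtr_ge0. Qed.

(** The norm of [R[i]] takes values in [R[i]]; passing to the real number [normc] makes real squeeze
    arguments available. *)
Lemma cvg_complexP {T} (F : set_system T) {FF : Filter F} (f : T -> R[i]) l :
  (fun u => f u : R[i]^o) @ F --> (l : R[i]^o) <->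
  (fun u => normc (f u - l)) @ F --> (0 : R).
Proof.
split=> fl; [apply/cvgr0Pnorm_lt => e e0|apply/cvgrPdist_lt => e e0].
  have e0' : 0 < e%:C :> R[i] by rewrite ltcR.
  near=> u; rewrite ger0_norm ?normc_ge0 // -ltcR -normCE distrC.
  by near: u; move/cvgrPdist_lt : fl; exact.
(* A positive element of [R[i]] is real, so [e] is its own real part. *)
have eE : e = (complex.Re e)%:C by apply/esym/RRe_real/gtr0_real.
have e0' : 0 < complex.Re e by rewrite -ltcR -eE.
near=> u; rewrite distrC eE normCE ltcR -[ltLHS]ger0_norm ?normc_ge0 //.
by near: u; move/cvgr0Pnorm_lt : fl; exact.
Unshelve. all: by end_near. Qed.

Lemma normcD z w : normc (z + w) <= normc z + normc w.
Proof. by rewrite -lecR rmorphD /= -!normCE ler_normD. Qed.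

Lemma normRe_le z : `|complex.Re z| <= normc z.
Proof. by rewrite -lecR -normCE normc_ge_Re. Qed.

Lemma normIm_le z : `|complex.Im z| <= normc z.
Proof.
by case: z => a b /=; rewrite -sqrtr_sqr ler_wsqrtr // lerDr sqr_ge0.
Qed.

Lemma normc_le_ReIm z : normc z <= `|complex.Re z| + `|complex.Im z|.
Proof.
case: z => a b /=; rewrite -[leRHS]ger0_norm ?addr_ge0 // -sqrtr_sqr.
rewrite ler_wsqrtr // sqrrD !real_normK ?num_real // lerD2r lerDl.
by rewrite mulrn_wge0 // mulr_ge0.
Qed.

Lemma cvg_real_complex {T} (F : set_system T) {FF : Filter F} (f : T -> R) a :
  f @ F --> a -> (fun u => (f u)%:C : R[i]^o) @ F --> (a%:C : R[i]^o).
Proof.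
move=> fa; apply/cvg_complexP.
under eq_fun do rewrite -rmorphB normc_real.
apply/cvgr0Pnorm_lt => e e0; near=> u; rewrite normr_id distrC.
by near: u; move/cvgrPdist_lt : fa; exact.
Unshelve. all: by end_near. Qed.

Lemma geometric_sum_le q n : 0 < q < 1 -> \sum_(j < n) q ^+ j <= (1 - q)^-1.
Proof.
move=> /andP[q0 q1].
rewrite -[leRHS]mul1r ler_pdivlMr ?subr_gt0 // mulrC -opprB mulNr -subrX1 opprB.
by rewrite gerBl exprn_ge0 // ltW.
Qed.

(** The telescoping series of [u] is dominated by a geometric series, whose sum bounds the distance
    from [u 0] to the limit. *)
Lemma cvg_geometric_steps (u : R^nat) q a : 0 < q < 1 -> 0 <= a ->
  (forall n, `|u n.+1 - u n| <= a * q ^+ n) ->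
  cvgn u /\ `|limn u - u 0%N| <= a / (1 - q).
Proof.
move=> /andP[q0 q1] a0 ustep.
have nq : `|q| < 1 by rewrite gtr0_norm.
have cnu : cvgn [normed series (telescope u)].
  apply: series_le_cvg (is_cvg_geometric_series (a := a) nq) => n /=.
  - exact: normr_ge0.
  - by rewrite mulr_ge0 // exprn_ge0 // ltW.
  - exact: ustep.
have cu : cvgn (series (telescope u)).
  exact: normed_cvg.
have uE : u = (fun n => u 0%N + series (telescope u) n).
  by apply/funext => m; exact: eq_sum_telescope.
have uc : u @ \oo --> u 0%N + limn (series (telescope u)).
  by rewrite {1}uE; apply: cvgD => //; exact: cvg_cst.
split; first by apply/cvg_ex; eexists; exact: uc.
rewrite (cvg_lim _ uc) // addrC addKr.
apply: le_trans (lim_series_norm cnu) _.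
rewrite -(cvg_lim _ (cvg_geometric_series (a := a) nq)) //.
apply: lim_series_le => //; exact: is_cvg_geometric_series.
Qed.

End Complex.

(** * The infinite product *)

Section QProduct.
Variable R : realType.
Implicit Types (q x t s a : R) (z w : R[i]).

(** Each factor has modulus at most [expR (q ^+ j * normc z)], and the exponents have a geometric
    sum. The bound is uniform in [n]. *)
Lemma normc_qprod_le q z n : 0 < q < 1 ->
  normc (\prod_(j < n) (1 + (q ^+ j)%:C * z)) <= expR (normc z / (1 - q)).
Proof.
move=> q01; have [q0 q1] := andP q01.
apply: (@le_trans _ _ (expR (\sum_(j < n) q ^+ j * normc z))).
  elim: n => [|n IH]; first by rewrite !big_ord0 normc1 expR0.
  rewrite !big_ord_recr /= normcM expRD ler_pM ?normc_ge0 //.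
  apply: le_trans (normcD _ _) _; rewrite normc1 normcM normc_real.
  by rewrite ger0_norm ?exprn_ge0 ?(ltW q0) // expR_ge1Dx.
rewrite ler_expR -mulr_suml mulrC ler_wpM2l ?normc_ge0 //.
exact: geometric_sum_le.
Qed.

Lemma qprod_step q z n :
  \prod_(j < n.+1) (1 + (q ^+ j)%:C * z) - \prod_(j < n) (1 + (q ^+ j)%:C * z)
  = \prod_(j < n) (1 + (q ^+ j)%:C * z) * ((q ^+ n)%:C * z).
Proof. by rewrite big_ord_recr /= mulrDr mulr1 [LHS]addrAC subrr add0r. Qed.

Lemma normc_qprod_step q z n : 0 < q < 1 ->
  normc (\prod_(j < n.+1) (1 + (q ^+ j)%:C * z) - \prod_(j < n) (1 + (q ^+ j)%:C * z))
  <= expR (normc z / (1 - q)) * normc z * q ^+ n.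
Proof.
move=> q01; have [q0 q1] := andP q01.
rewrite qprod_step !normcM normc_real ger0_norm ?exprn_ge0 ?(ltW q0) //.
rewrite [(q ^+ n) * _]mulrC mulrA ler_wpM2r ?exprn_ge0 ?(ltW q0) //.
by rewrite ler_wpM2r ?normc_ge0 // normc_qprod_le.
Qed.

(** Real and imaginary parts of the partial products each have geometrically small steps, so each
    converges in [R]. *)
Lemma cvg_qinfty q z : 0 < q < 1 ->
  (fun n => \prod_(j < n) (1 + (q ^+ j)%:C * z) : R[i]^o) @ \oo
    --> (qinfty q z : R[i]^o).
Proof.
move=> q01; set p := (fun n => _).
have M0 : 0 <= expR (normc z / (1 - q)) * normc z.
  by rewrite mulr_ge0 ?normc_ge0 ?expR_ge0.
have [cRe _] : cvgn (fun n => complex.Re (p n)) /\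
    `|limn (fun n => complex.Re (p n)) - complex.Re (p 0%N)| <=
      expR (normc z / (1 - q)) * normc z / (1 - q).
  apply: cvg_geometric_steps => // n; rewrite -raddfB.
  exact: le_trans (normRe_le _) (normc_qprod_step _ _ q01).
have [cIm _] : cvgn (fun n => complex.Im (p n)) /\
    `|limn (fun n => complex.Im (p n)) - complex.Im (p 0%N)| <=
      expR (normc z / (1 - q)) * normc z / (1 - q).
  apply: cvg_geometric_steps => // n; rewrite -raddfB.
  exact: le_trans (normIm_le _) (normc_qprod_step _ _ q01).
suff cp : p @ \oo --> ((limn (fun n => complex.Re (p n)) +i*
    limn (fun n => complex.Im (p n))) : R[i]^o).
  by apply/cvg_ex; eexists; exact: cp.
apply/cvg_complexP; apply: (@squeeze_cvgr _ _ _ _ (fun=> 0)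
   (fun n => `|complex.Re (p n) - limn (fun n => complex.Re (p n))| +
     `|complex.Im (p n) - limn (fun n => complex.Im (p n))|)).
- apply: nearW => n; rewrite normc_ge0 /=; apply: le_trans (normc_le_ReIm _) _.
  by rewrite !raddfB.
- exact: cvg_cst.
- rewrite -[X in _ --> X](addr0 0); apply: cvgD; rewrite -[X in _ --> X](normr0 R);
  apply: cvg_norm; apply/subr_cvg0 => //.
Qed.

Lemma qinfty_recl q z : 0 < q < 1 ->
  qinfty q z = (1 + z) * qinfty q (q%:C * z).
Proof.
move=> q01; have := @cvg_qinfty q z q01.
rewrite -(cvg_shiftS (fun n => \prod_(j < n) (1 + (q ^+ j)%:C * z) : R[i]^o)) => cz.
have cqz : (fun n => \prod_(j < n.+1) (1 + (q ^+ j)%:C * z) : R[i]^o) @ \oo -->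
  ((1 + z) * qinfty q (q%:C * z) : R[i]^o).
  under eq_fun do rewrite big_ord_recl /= expr0 mul1r.
  apply: cvgM; first exact: cvg_cst.
  under eq_fun do under eq_bigr do rewrite /bump /= exprSr rmorphM /= -mulrA.
  exact: cvg_qinfty.
exact: cvg_unique cz cqz.
Qed.

Definition rqinfty q a := limn (fun n => \prod_(j < n) (1 + q ^+ j * a)).

Lemma qprod_real q a n : \prod_(j < n) (1 + (q ^+ j)%:C * a%:C) =
  (\prod_(j < n) (1 + q ^+ j * a))%:C.
Proof. by rewrite rmorph_prod; apply: eq_bigr => j _; rewrite rmorphD rmorphM. Qed.

(** The empty product is 1, so the bound on the distance to the first term applies. Its vanishing as
    [a] tends to 0 gives the limit [q -> 0] of [K]. *)
Lemma rqinfty_spec q a : 0 < q < 1 ->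
  cvgn (fun n => \prod_(j < n) (1 + q ^+ j * a)) /\
  `|rqinfty q a - 1| <= expR (`|a| / (1 - q)) * `|a| / (1 - q).
Proof.
move=> q01.
have [] := @cvg_geometric_steps _ (fun n => \prod_(j < n) (1 + q ^+ j * a)) q
  (expR (`|a| / (1 - q)) * `|a|) q01.
- by rewrite mulr_ge0 ?expR_ge0.
- move=> n; have := normc_qprod_step a%:C n q01.
  by rewrite !qprod_real -rmorphB !normc_real.
- by rewrite big_ord0.
Qed.

Lemma qinfty_real q a : 0 < q < 1 -> qinfty q a%:C = (rqinfty q a)%:C.
Proof.
move=> q01; rewrite /qinfty (funext (qprod_real q a)).
apply: (@cvg_lim R[i]^o); first exact: norm_hausdorff.
by apply: cvg_real_complex; exact: (rqinfty_spec a q01).1.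
Qed.

Lemma rqinfty_recl q a : 0 < q < 1 ->
  rqinfty q a = (1 + a) * rqinfty q (q * a).
Proof.
move=> q01; apply: complexI.
rewrite -qinfty_real // (rmorphM (real_complex R)) /= -qinfty_real //.
by rewrite (rmorphM (real_complex R)) (rmorphD (real_complex R)) -qinfty_recl.
Qed.

Lemma rqinfty_ge1 q a : 0 < q < 1 -> 0 <= a -> 1 <= rqinfty q a.
Proof.
move=> q01 a0; apply: limr_ge; first exact: (rqinfty_spec a q01).1.
apply: nearW => n; elim: n => [|n IH]; first by rewrite big_ord0.
rewrite big_ord_recr /=; apply: mulr_ege1 => //.
by case/andP: q01 => q0 _; rewrite lerDl mulr_ge0 // exprn_ge0 // ltW.
Qed.

End QProduct.

(** * The recurrences in t and in x *)

Section Recurrence.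
Variable R : realType.
Implicit Types (q x s a : R) (t z w : R[i]).

(** * Complex exponential and complex powers of real numbers *)

Lemma cexpD z w : cexp (z + w) = cexp z * cexp w.
Proof.
case: z w => [a b] [c d]; rewrite /cexp /= expRD cosD sinD.
by apply/eqP; rewrite eq_complex /=; apply/andP; split; apply/eqP; ring.
Qed.

Lemma cexp_neq0 z : cexp z != 0.
Proof.
apply/negP => /eqP z0; have := cexpD z (- z).
rewrite z0 mul0r subrr /cexp /= expR0 cos0 sin0 mul1r => /eqP.
by rewrite eq_complex /= oner_eq0.
Qed.

Lemma cpowD x t z : cpow x (t + z) = cpow x t * cpow x z.
Proof. by rewrite /cpow mulrDl cexpD. Qed.

Lemma cpow0 x : cpow x 0 = 1.
Proof. by rewrite /cpow mul0r /cexp /= expR0 cos0 sin0 mul1r. Qed.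

Lemma cpow_neq0 x t : cpow x t != 0.
Proof. exact: cexp_neq0. Qed.

Lemma cpowB x t z : cpow x (t - z) = cpow x t / cpow x z.
Proof. by apply: canRL (mulfK (cpow_neq0 x z)) _; rewrite -cpowD subrK. Qed.

Lemma cpow1 x : x != 0 -> cpow x 1 = x%:C.
Proof.
move=> x0; rewrite /cpow mul1r /clog /cexp /= lnK ?posrE ?normr_gt0 //.
case: ltP => xlt; [rewrite ltr0_norm // cospi sinpi|rewrite ger0_norm // cos0 sin0].
  by apply/eqP; rewrite eq_complex /= !mul0r !mulr0 mulrN1 opprK addr0 subr0 !eqxx.
by rewrite mulr1.
Qed.

Lemma cpow_real x s : 0 < x -> cpow x s%:C = (x `^ s)%:C.
Proof.
move=> x0; rewrite /cpow /clog /powR gt_eqF // ltNge ltW //= gtr0_norm // /cexp.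
by rewrite /= !mul0r !mulr0 addr0 subr0 cos0 sin0 mulr1.
Qed.

(** A positive factor does not change the sign of [x], so both logarithms lie on the same branch. *)
Lemma cpowMl q x t : 0 < q -> x != 0 -> cpow (q * x) t = cpow q t * cpow x t.
Proof.
move=> q0 x0; rewrite /cpow -cexpD -mulrDr /clog normrM pmulr_rlt0 //.
rewrite lnM ?posrE ?normr_gt0 ?(gt_eqF q0) //.
have -> : (q < 0) = false by apply/negbTE; rewrite -leNgt ltW.
by congr (cexp (t * _)); apply/eqP; rewrite eq_complex /= add0r !eqxx.
Qed.

(** Writing [q ^ (1 - t)] as [q / q ^ t] leaves [cpow q t] as the only power of [q], which suits
    [field]. *)
Lemma KE q x t : 0 < q -> K q x t = (1 + x%:C)^-1 * cpow x t *
  (qinfty q x%:C^-1 / qinfty q (cpow q t * x%:C^-1)) *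
  (qinfty q x%:C / qinfty q (q%:C * ((cpow q t)^-1 * x%:C))).
Proof.
by move=> q0; rewrite /K /qpow !div1r cpowB cpow1 ?(gt_eqF q0) // -[_ / _ * x%:C]mulrA.
Qed.

Lemma K_definedE q x t : 0 < q -> K_defined q x t <->
  [/\ x%:C != 0, 1 + x%:C != 0, qinfty q (cpow q t * x%:C^-1) != 0
    & qinfty q (q%:C * ((cpow q t)^-1 * x%:C)) != 0].
Proof.
move=> q0; rewrite /K_defined !div1r cpowB cpow1 ?(gt_eqF q0) // -[_ / _ * x%:C]mulrA.
by rewrite (fmorph_eq0 (real_complex R)).
Qed.

(** P(1/z) and P(z) have the extra factors 1 + 1/z and 1 + z, which vanish together. *)
Lemma qinfty_neq0_shift q z : 0 < q < 1 -> z != 0 ->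
  (qinfty q z^-1 != 0) && (qinfty q (q%:C * z) != 0) =
  (qinfty q (q%:C / z) != 0) && (qinfty q z != 0).
Proof.
move=> q01 z0; rewrite [qinfty q z^-1]qinfty_recl // [qinfty q z]qinfty_recl //.
rewrite !mulf_eq0 !negb_or.
have -> : (1 + z^-1 != 0) = (1 + z != 0).
  by rewrite -[1 + z^-1 == 0](mulIr_eq0 _ (mulIf z0)) mulrDl mul1r mulVf // addrC.
by case: (1 + z != 0); rewrite //= andbF.
Qed.

Lemma K_defined_shift q x t : 0 < q < 1 ->
  K_defined q x (t + 1) <-> K_defined q x t.
Proof.
move=> q01; have [q0 q1] := andP q01; have ta0 := cpow_neq0 q t.
rewrite !K_definedE // cpowD cpow1 ?(gt_eqF q0) //.
have qC0 : q%:C != 0 by rewrite (fmorph_eq0 (real_complex R)) (gt_eqF q0).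
have [->|x0] := eqVneq (x%:C) 0; first by split=> -[/eqP].
(* With z = q^(-t) x, the denominators at [t] are P(1/z) and P(q z), those at [t + 1] are P(q/z) and
   P(z). *)
have z0 : (cpow q t)^-1 * x%:C != 0 by rewrite mulf_neq0 ?invr_eq0.
have := qinfty_neq0_shift q01 z0.
have -> : q%:C / ((cpow q t)^-1 * x%:C) = cpow q t * q%:C * x%:C^-1.
  by field; exact/andP.
have -> : ((cpow q t)^-1 * x%:C)^-1 = cpow q t * x%:C^-1 by rewrite invfM invrK.
have -> : q%:C * ((cpow q t * q%:C)^-1 * x%:C) = (cpow q t)^-1 * x%:C.
  by field; exact/andP.
move=> E; split=> -[_ x1 h1 h2]; split=> //.
- by move: E; rewrite h1 h2 => /andP[].
- by move: E; rewrite h1 h2 => /andP[].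
- by move: E; rewrite h1 h2 => /esym/andP[].
- by move: E; rewrite h1 h2 => /esym/andP[].
Qed.

(** By P(a) = (1 + a) P(q a) the quotient of the two sides' values of [K] is x (1 + q^t / x) / (1 +
    q^(-t) x) = q^t. *)
Lemma K_shift q x t : 0 < q < 1 -> K_defined q x t ->
  K q x (t + 1) = cpow q t * K q x t.
Proof.
move=> q01 dt; have [q0 q1] := andP q01; have ta0 := cpow_neq0 q t.
have /(K_defined_shift x t q01) := dt.
move: dt; rewrite !K_definedE // => -[x0 x1 h1 h2] [_ _ h3 h4].
have qC0 : q%:C != 0 by rewrite (fmorph_eq0 (real_complex R)) (gt_eqF q0).
move: h1 h2 h3 h4; rewrite !KE // !cpowD !cpow1 ?(gt_eqF q0) //; last first.
  by rewrite -(fmorph_eq0 (real_complex R)).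
have -> : q%:C * ((cpow q t * q%:C)^-1 * x%:C) = (cpow q t)^-1 * x%:C.
  by field; exact/andP.
have -> : cpow q t * q%:C * x%:C^-1 = q%:C * (cpow q t * x%:C^-1) by field.
rewrite [qinfty q (cpow q t * _)]qinfty_recl //.
rewrite [qinfty q ((cpow q t)^-1 * _)]qinfty_recl //.
rewrite !mulf_eq0 !negb_or => /andP[n1 n2] n3 _ _.
have n1' : x%:C + cpow q t != 0.
  apply: contra n1 => /eqP xa; apply/eqP.
  by rewrite -[RHS](mul0r (x%:C^-1)) -xa; field.
have n1'' : cpow q t + x%:C != 0 by rewrite addrC.
field; rewrite ?x0 ?x1 ?n2 ?n3 ?n1' ?n1'' ?ta0 //.
Qed.

Lemma K0 q x : 0 < q < 1 -> K_defined q x 0 -> K q x 0 = 1.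
Proof.
move=> q01; have [q0 q1] := andP q01.
rewrite K_definedE // KE // !cpow0 invr1 !mul1r [qinfty q x%:C]qinfty_recl //.
by move=> [x0 x1 h1 h2]; field; rewrite x1 h1 h2.
Qed.

Lemma K_nat q x (n : nat) : 0 < q < 1 -> K_defined q x n%:R ->
  K q x n%:R = (q ^+ 'C(n, 2))%:C.
Proof.
move=> q01; have [q0 q1] := andP q01.
elim: n => [|n IH] d; first by rewrite K0.
rewrite -addn1 natrD in d *.
have dn : K_defined q x n%:R by apply/(K_defined_shift x n%:R q01).
rewrite K_shift // IH //.
have -> : n%:R = n%:R%:C :> R[i] by rewrite (rmorph_nat (real_complex R)).
rewrite cpow_real // -rmorphM /= powR_mulrn ?ltW // -exprD.
by rewrite addn1 binS bin1 addnC.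
Qed.

(* If [1 + x] or [1 + q * x] vanishes then both sides are [0], because of the
   division by [0] on one side and of a vanishing factor on the other. *)
Lemma K_mulq q x t : 0 < q < 1 -> x != 0 ->
  qinfty q (cpow q t * x%:C^-1) != 0 ->
  qinfty q (q%:C * ((cpow q t)^-1 * x%:C)) != 0 ->
  [/\ qinfty q (cpow q t * (q * x)%:C^-1) != 0,
    qinfty q (q%:C * ((cpow q t)^-1 * (q * x)%:C)) != 0 &
    K q (q * x) t = K q x t].
Proof.
move=> q01 xn0 h1 h2; have [q0 q1] := andP q01; have ta0 := cpow_neq0 q t.
have qC0 : q%:C != 0 by rewrite (fmorph_eq0 (real_complex R)) (gt_eqF q0).
have x0 : x%:C != 0 by rewrite (fmorph_eq0 (real_complex R)).
rewrite !KE // cpowMl // (rmorphM (real_complex R)) /=.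
(* The first factor of P(q^(1-t) x) is nonzero, hence so is q^t + q x. This is what makes the new
   factor of the other denominator, 1 + q^t / (q x), nonzero. *)
move: h2; rewrite qinfty_recl // mulf_eq0 negb_or => /andP[n1 n2].
have n3 : cpow q t + q%:C * x%:C != 0.
  apply: contra n1 => /eqP e; apply/eqP.
  by rewrite -[RHS](mulr0 (cpow q t)^-1) -e; field.
have n3' : q%:C * x%:C + cpow q t != 0 by rewrite addrC.
have e1 : qinfty q (cpow q t * (q%:C * x%:C)^-1) =
    (1 + cpow q t / (q%:C * x%:C)) * qinfty q (cpow q t * x%:C^-1).
  by rewrite qinfty_recl //; congr (_ * qinfty q _); field; exact/andP.
have e2 : q%:C * ((cpow q t)^-1 * (q%:C * x%:C)) =
    q%:C * (q%:C * ((cpow q t)^-1 * x%:C)).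
  by ring.
have n4 : 1 + cpow q t / (q%:C * x%:C) != 0.
  apply: contra n3' => /eqP e; apply/eqP.
  by rewrite -[RHS](mulr0 (q%:C * x%:C)) -e; field; exact/andP.
rewrite e1 e2; split; rewrite ?mulf_neq0 //.
have e3 : qinfty q (q%:C * x%:C)^-1 = (1 + (q%:C * x%:C)^-1) * qinfty q x%:C^-1.
  by rewrite qinfty_recl //; congr (_ * qinfty q _); field; exact/andP.
have e4 : qinfty q x%:C = (1 + x%:C) * qinfty q (q%:C * x%:C) by rewrite qinfty_recl.
rewrite e3.
have [x1|x1] := eqVneq (1 + x%:C) 0.
  have -> : qinfty q x%:C^-1 = 0.
    rewrite qinfty_recl // -[1 + _](mulKf x0) mulrDr mulr1 mulfV // addrC x1.
    by rewrite mulr0 mul0r.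
  by rewrite !(mulr0, mul0r).
have [qx1|qx1] := eqVneq (1 + q%:C * x%:C) 0.
  rewrite e4 [qinfty q (q%:C * x%:C)]qinfty_recl // qx1.
  by rewrite invr0 !(mul0r, mulr0).
rewrite e4; field.
by rewrite ?n1 ?n2 ?n3 ?n3' ?h1 ?ta0 ?qC0 ?x0 ?x1 ?qx1.
Qed.

(** At an intermediate point 1 + q^j x may vanish, so the induction carries only the conditions on
    the infinite products, not [K_defined]. *)
Lemma K_mulXn q x t (n : nat) : 0 < q < 1 -> x != 0 ->
  qinfty q (cpow q t * x%:C^-1) != 0 ->
  qinfty q (q%:C * ((cpow q t)^-1 * x%:C)) != 0 ->
  K q (q ^+ n * x) t = K q x t.
Proof.
move=> q01; have [q0 _] := andP q01.
elim: n x => [|n IH] x x0 h1 h2; first by rewrite expr0 mul1r.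
have [h3 h4 <-] := K_mulq q01 x0 h1 h2.
have -> : q ^+ n.+1 * x = q ^+ n * (q * x) by rewrite exprSr mulrA.
by rewrite IH // mulf_neq0 // gt_eqF.
Qed.

Lemma K_mulXz q x t (n : int) : 0 < q < 1 ->
  K_defined q x t -> K_defined q (q ^ n * x) t -> K q (q ^ n * x) t = K q x t.
Proof.
move=> q01; have [q0 _] := andP q01; rewrite !K_definedE // => d d'.
case: n d' => n d'.
  by case: d => x0 _ h1 h2; rewrite K_mulXn // -(fmorph_eq0 (real_complex R)).
case: d' => x0 _ h1 h2.
(* For a negative exponent the roles are exchanged: [n.+1] steps lead from the scaled point back to
   [x]. *)
rewrite NegzE -(@K_mulXn q _ t n.+1) //.
  by rewrite mulrA exprnP -expfzDr ?gt_eqF // subrr expr0z mul1r.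
by rewrite -(fmorph_eq0 (real_complex R)).
Qed.

Lemma Dq_K q x t : 0 < q < 1 -> K_defined q x t ->
  Dq q (fun y => K q y t) x = 0.
Proof.
move=> q01; have [q0 _] := andP q01; rewrite K_definedE // => -[x0 _ h1 h2].
have xn0 : x != 0 by rewrite -(fmorph_eq0 (real_complex R)).
by have [_ _ E] := K_mulq q01 xn0 h1 h2; rewrite /Dq E subrr mul0r.
Qed.
End Recurrence.

(** * Log-convexity of the infinite product *)

Section LogConvexity.
Variable R : realType.
Implicit Types (q x s t a u v : R).

Lemma gt0_powRD x s t : 0 < x -> x `^ (s + t) = x `^ s * x `^ t.
Proof. by move=> x0; rewrite powRD // (gt_eqF x0) implybT. Qed.

(** Weighted AM-GM. The exponential lies above its tangent at [m], the weighted mean of the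
    logarithms, where the linear terms cancel. *)
Lemma young_powR u v s : 0 < u -> 0 < v -> 0 <= s <= 1 ->
  u `^ (1 - s) * v `^ s <= (1 - s) * u + s * v.
Proof.
move=> u0 v0 /andP[s0 s1]; rewrite /powR !gt_eqF // -expRD.
set m := _ + _.
have le w : 0 < w -> expR m * (1 + (ln w - m)) <= w.
  move=> w0; rewrite -[leRHS]lnK ?posrE // -[in leRHS](subrKC m (ln w)).
  rewrite [expR (m + _)]expRD.
  by rewrite ler_wpM2l ?expR_ge0 // expR_ge1Dx.
have -> : expR m = (1 - s) * (expR m * (1 + (ln u - m))) +
    s * (expR m * (1 + (ln v - m))) by rewrite /m; ring.
by rewrite lerD // ler_wpM2l ?subr_ge0 // le.
Qed.

(** Hölder's inequality for two terms, since q^s a = a^(1-s) (q a)^s. *)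
Lemma rqfactor_log_convex q a s : 0 < q -> 0 < a -> 0 <= s <= 1 ->
  1 + q `^ s * a <= (1 + a) `^ (1 - s) * (1 + q * a) `^ s.
Proof.
move=> q0 a0 s01; have qa0 : 0 < q * a by rewrite mulr_gt0.
have X0 : 0 < 1 + a by rewrite addr_gt0.
have Y0 : 0 < 1 + q * a by rewrite addr_gt0.
have c0 : 0 < (1 + a) `^ (1 - s) * (1 + q * a) `^ s by rewrite mulr_gt0 ?powR_gt0.
have invP w r : 0 < w -> w^-1 `^ r = (w `^ r)^-1.
  by move=> w0; rewrite /powR !gt_eqF ?invr_gt0 // lnV ?posrE // mulrN expRN.
rewrite -[leRHS]mulr1 -ler_pdivrMl //.
(* After division by the right-hand side, weighted AM-GM applies to each of the two terms, and the
   two means add up to 1. *)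
rewrite [leRHS](_ : 1 = (1 - s) * (1 + a)^-1 + s * (1 + q * a)^-1 +
   ((1 - s) * (a / (1 + a)) + s * (q * a / (1 + q * a)))); last first.
  by field; rewrite !gt_eqF.
rewrite mulrDr mulr1; apply: lerD.
  apply: le_trans (young_powR _ _ s01); rewrite ?invr_gt0 //.
  by rewrite invfM !invP.
apply: le_trans (young_powR _ _ s01); rewrite ?divr_gt0 //.
rewrite !powRM ?invr_ge0 ?(ltW q0) ?(ltW a0) ?(ltW X0) ?(ltW Y0) ?(ltW qa0) //.
rewrite !invP // invfM.
have aE : a = a `^ (1 - s) * a `^ s.
  by rewrite -gt0_powRD // subrK powRr1 // ltW.
by rewrite [X in q `^ s * X]aE le_eqVlt; apply/orP; left; apply/eqP; ring.
Qed.

Lemma rqprod_le q a n : 0 < q < 1 -> 0 <= a ->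
  \prod_(j < n) (1 + q ^+ j * a) <= rqinfty q a.
Proof.
move=> q01 a0; have [q0 _] := andP q01.
apply: (@nondecreasing_cvgn_le _ (fun n => \prod_(j < n) (1 + q ^+ j * a))).
  apply/nondecreasing_seqP => m; rewrite big_ord_recr /= ler_peMr //.
    by apply: prodr_ge0 => j _; rewrite addr_ge0 // mulr_ge0 // exprn_ge0 // ltW.
  by rewrite lerDl mulr_ge0 // exprn_ge0 // ltW.
exact: (rqinfty_spec a q01).1.
Qed.

Lemma rqinfty_gt0 q a : 0 < q < 1 -> 0 <= a -> 0 < rqinfty q a.
Proof. by move=> q01 a0; apply: lt_le_trans (rqinfty_ge1 q01 a0). Qed.

Lemma rqinfty_log_convex q a s : 0 < q < 1 -> 0 < a -> 0 <= s <= 1 ->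
  rqinfty q (q `^ s * a) <= rqinfty q a `^ (1 - s) * rqinfty q (q * a) `^ s.
Proof.
move=> q01 a0 s01; have [q0 _] := andP q01; have [s0 s1] := andP s01.
have qa0 : 0 < q * a by rewrite mulr_gt0.
apply: limr_le; first exact: (rqinfty_spec _ q01).1.
apply: nearW => n.
have p0 b m : 0 < b -> 0 <= \prod_(j < m) (1 + q ^+ j * b).
  by move=> b0; apply: prodr_ge0 => j _; rewrite addr_ge0 // mulr_ge0 ?exprn_ge0 // ltW.
apply: (@le_trans _ _ ((\prod_(j < n) (1 + q ^+ j * a)) `^ (1 - s) *
    (\prod_(j < n) (1 + q ^+ j * (q * a))) `^ s)).
  elim: n => [|n IH]; first by rewrite !big_ord0 !powR1 mulr1.
  rewrite !big_ord_recr /= !powRM ?p0 //; last first.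
  - by rewrite addr_ge0 // mulr_ge0 ?exprn_ge0 // ltW.
  - by rewrite addr_ge0 // mulr_ge0 ?exprn_ge0 // ltW.
  rewrite mulrACA ler_pM //.
  - by rewrite p0 // mulr_gt0 ?powR_gt0.
  - by rewrite addr_ge0 // !mulr_ge0 ?exprn_ge0 ?powR_ge0 // ltW.
  rewrite mulrCA [q ^+ n * (q * a)]mulrCA rqfactor_log_convex //.
  by rewrite mulr_gt0 // exprn_gt0.
(* Partial products lie below their limits, so only the left-hand side has to pass to the limit. *)
rewrite ler_pM ?powR_ge0 // ge0_ler_powR ?subr_ge0 //;
  rewrite ?nnegrE ?p0 ?rqprod_le ?(ltW (rqinfty_gt0 _ _)) ?ltW //.
Qed.

(** Multiply the log-convexity bound by (1 + a)^s: as (1 + a) P(q a) = P(a), its right-hand side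
    becomes P(a)^(1-s) P(a)^s. *)
Lemma rqinfty_ratio_ge q a s : 0 < q < 1 -> 0 < a -> 0 <= s <= 1 ->
  (1 + a) `^ s <= rqinfty q a / rqinfty q (q `^ s * a).
Proof.
move=> q01 a0 s01; have [q0 _] := andP q01.
have qa0 : 0 < q * a by rewrite mulr_gt0.
have P0 := rqinfty_gt0 q01 (ltW a0); have Pq0 := rqinfty_gt0 q01 (ltW qa0).
rewrite ler_pdivlMr; last by rewrite rqinfty_gt0 // mulr_ge0 ?powR_ge0 // ltW.
apply: le_trans (ler_wpM2l (powR_ge0 _ _) (rqinfty_log_convex q01 a0 s01)) _.
rewrite mulrCA -powRM ?addr_ge0 ?(ltW a0) ?(ltW Pq0) // -rqinfty_recl //.
by rewrite -gt0_powRD // subrK powRr1 // ltW.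
Qed.

(** The lower bound at b = q^(s-1) a with exponent 1 - s bounds P(b) / P(a), because q^(1-s) b = a.
    As P(b) = (1 + b) P(q b) and q b = q^s a, this bounds the desired ratio from above. *)
Lemma rqinfty_ratio_le q a s : 0 < q < 1 -> 0 < a -> 0 <= s <= 1 ->
  rqinfty q a / rqinfty q (q `^ s * a) <= (1 + q `^ (s - 1) * a) `^ s.
Proof.
move=> q01 a0 s01; have [q0 _] := andP q01; have [s0 s1] := andP s01.
set b := q `^ (s - 1) * a.
have b0 : 0 < b by rewrite mulr_gt0 ?powR_gt0.
have qb : q `^ s * a = q * b.
  by rewrite /b mulrA -[X in X * _ * _]powRr1 ?(ltW q0) // -gt0_powRD // subrKC.
have qsb : q `^ (1 - s) * b = a.
  by rewrite /b mulrA -gt0_powRD // addrA subrK subrr powRr0 mul1r.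
have s'01 : 0 <= 1 - s <= 1 by rewrite subr_ge0 s1 gerBl s0.
have := rqinfty_ratio_ge q01 b0 s'01; rewrite qsb qb [rqinfty q b]rqinfty_recl //.
have P0 := rqinfty_gt0 q01 (ltW a0).
have Pq0 : 0 < rqinfty q (q * b) by rewrite rqinfty_gt0 // mulr_ge0 ?ltW.
have c0 : 0 < 1 + b by rewrite addr_gt0.
rewrite ler_pdivlMr // ler_pdivrMr // => h.
rewrite -(ler_pM2l (powR_gt0 (1 - s) c0)) mulrA -gt0_powRD //.
by rewrite subrK powRr1 ?(ltW c0).
Qed.

Lemma cvg_powR {T} (F : set_system T) {FF : Filter F} (f : T -> R) a s : 0 < a ->
  f @ F --> a -> (fun i => f i `^ s) @ F --> a `^ s.
Proof.
move=> a0 fa.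
have -> : a `^ s = expR (s * ln a) by rewrite /powR gt_eqF.
apply: (@cvg_trans _ ((fun i => expR (s * ln (f i))) @ F)).
  apply: near_eq_cvg; near=> u; rewrite /powR gt_eqF //.
  by near: u; exact: cvgr_gt fa _ a0.
apply: continuous_cvg; first exact: continuous_expR.
apply: cvgM; first exact: cvg_cst.
by apply: continuous_cvg => //; exact: continuous_ln.
Unshelve. all: by end_near. Qed.

(** * The function K in real terms *)

Definition rK q x t := (1 + x)^-1 * x `^ t *
  (rqinfty q x^-1 / rqinfty q (q `^ t * x^-1)) *
  (rqinfty q x / rqinfty q (q `^ (1 - t) * x)).

Lemma powR_subl q t : 0 < q -> q * (q `^ t)^-1 = q `^ (1 - t).
Proof. by move=> q0; rewrite gt0_powRD // powRr1 ?(ltW q0) // powRN. Qed.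

(** Also for negative [x]: only the factor [cpow x t%:C] may then fail to be real. *)
Lemma K_realE q x t : 0 < q < 1 -> K q x t%:C = (1 + x%:C)^-1 * cpow x t%:C *
  (rqinfty q x^-1 / rqinfty q (q `^ t * x^-1))%:C *
  (rqinfty q x / rqinfty q (q `^ (1 - t) * x))%:C.
Proof.
move=> q01; have [q0 _] := andP q01; rewrite KE // (cpow_real _ q0) -powR_subl //.
have e2 : (q `^ t)%:C * x%:C^-1 = (q `^ t * x^-1)%:C.
  by rewrite (rmorphM (real_complex R)) (fmorphV (real_complex R)).
have e3 : q%:C * ((q `^ t)%:C^-1 * x%:C) = (q * (q `^ t)^-1 * x)%:C.
  by rewrite !(rmorphM (real_complex R)) (fmorphV (real_complex R)) mulrA.
rewrite e2 e3 -(fmorphV (real_complex R)) !qinfty_real //.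
by rewrite -!(fmorph_div (real_complex R)).
Qed.

Lemma rKE q x t : 0 < q < 1 -> 0 < x -> K q x t%:C = (rK q x t)%:C.
Proof.
move=> q01 x0; rewrite K_realE // cpow_real // /rK.
rewrite !(rmorphM (real_complex R)) !(fmorphV (real_complex R)).
by rewrite (rmorphD (real_complex R)).
Qed.

Lemma K_defined_gt0 q x t : 0 < q < 1 -> 0 < x -> K_defined q x t%:C.
Proof.
move=> q01 x0; have [q0 _] := andP q01; apply/K_definedE => //.
have x0' : 0 < x^-1 by rewrite invr_gt0.
rewrite (cpow_real _ q0) -!(fmorphV (real_complex R)) -!(rmorphM (real_complex R)).
rewrite -(rmorphD (real_complex R) 1) mulrA.
rewrite !qinfty_real // !(fmorph_eq0 (real_complex R)) powR_subl //.
by split; rewrite gt_eqF ?addr_gt0 ?rqinfty_gt0 // mulr_ge0 ?powR_ge0 ?ltW.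
Qed.

End LogConvexity.

(** * Limits of K *)

Section KLimits.
Variable R : realType.
Implicit Types (q x s t a u v : R).

(** The ratio bounds are used at 1/x with exponent [t] and at [x] with exponent [1 - t]. The lower
    ones multiply to exactly 1, since x^t (1 + 1/x)^t = (1 + x)^t. *)
Lemma rK_bounds q x t : 0 < q < 1 -> 0 < x -> 0 <= t <= 1 ->
  1 <= rK q x t <= (1 + x)^-1 * x `^ t * (1 + q `^ (t - 1) * x^-1) `^ t *
     (1 + q `^ (- t) * x) `^ (1 - t).
Proof.
move=> q01 x0 t01; have [t0 t1] := andP t01; have [q0 _] := andP q01.
have t'01 : 0 <= 1 - t <= 1 by rewrite subr_ge0 t1 gerBl t0.
have x'0 : 0 < x^-1 by rewrite invr_gt0.
have X0 : 0 < 1 + x by rewrite addr_gt0.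
have c0 : 0 <= (1 + x)^-1 * x `^ t by rewrite mulr_ge0 ?powR_ge0 // invr_ge0 ltW.
have A := rqinfty_ratio_ge q01 x'0 t01; have B := rqinfty_ratio_ge q01 x0 t'01.
have A' := rqinfty_ratio_le q01 x'0 t01; have B' := rqinfty_ratio_le q01 x0 t'01.
rewrite [1 - t - 1]addrAC subrr add0r in B'; apply/andP; split.
  apply: (@le_trans _ _ ((1 + x)^-1 * x `^ t * (1 + x^-1) `^ t * (1 + x) `^ (1 - t))).
    rewrite -[(1 + x)^-1 * _ * _]mulrA -powRM ?(ltW x0) ?addr_ge0 ?(ltW x'0) //.
    rewrite mulrDr mulr1 mulfV ?gt_eqF // [x + 1]addrC -mulrA -gt0_powRD //.
    by rewrite subrKC powRr1 ?(ltW X0) // mulVf // gt_eqF.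
  by apply: ler_pM => //; rewrite ?(mulr_ge0 c0) ?powR_ge0 // ler_wpM2l.
have rP s a : 0 <= a -> 0 <= rqinfty q a / rqinfty q (q `^ s * a).
  by move=> a0; rewrite divr_ge0 // ltW // rqinfty_gt0 // mulr_ge0 ?powR_ge0.
by apply: ler_pM => //; rewrite ?(mulr_ge0 c0) ?rP ?(ltW x0) ?(ltW x'0) // ler_wpM2l.
Qed.

Lemma cvg_powR1 (F : set_system R) {FF : Filter F} t :
  F --> (1 : R) -> (fun q => q `^ t) @ F --> (1 : R).
Proof.
move=> F1; have -> : (1 : R) = 1 `^ t by rewrite powR1.
exact: cvg_powR.
Qed.

Lemma rK_cvg1 (F : set_system R) {FF : Filter F} x t :
  F --> (1 : R) -> (\forall q \near F, 0 < q < 1) -> 0 < x -> 0 <= t <= 1 ->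
  (fun q => rK q x t) @ F --> (1 : R).
Proof.
move=> F1 F01 x0 t01.
apply: (@squeeze_cvgr _ _ _ _ (fun=> 1) (fun q => (1 + x)^-1 * x `^ t *
   (1 + q `^ (t - 1) * x^-1) `^ t * (1 + q `^ (- t) * x) `^ (1 - t))).
- by near=> q; apply: rK_bounds => //; near: q.
- exact: cvg_cst.
have X0 : 0 < 1 + x by rewrite addr_gt0.
(* At [q = 1] the upper bound coincides with the lower one. *)
have one : (1 + x)^-1 * x `^ t * (1 + 1 * x^-1) `^ t * (1 + 1 * x) `^ (1 - t) = 1.
  rewrite !mul1r -[(1 + x)^-1 * _ * _]mulrA.
  rewrite -powRM ?(ltW x0) ?addr_ge0 ?invr_ge0 ?(ltW x0) //.
  rewrite mulrDr mulr1 mulfV ?gt_eqF // [x + 1]addrC -mulrA -gt0_powRD //.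
  by rewrite subrKC powRr1 ?(ltW X0) // mulVf // gt_eqF.
rewrite -[X in _ --> X]one; apply: cvgM; first apply: cvgM.
- exact: cvg_cst.
- apply: (@cvg_powR _ _ _ _ (fun q => 1 + q `^ (t - 1) * x^-1)).
    by rewrite mul1r addr_gt0 ?invr_gt0.
  apply: cvgD; first exact: cvg_cst.
  by apply: cvgM; [exact: cvg_powR1|exact: cvg_cst].
- apply: (@cvg_powR _ _ _ _ (fun q => 1 + q `^ (- t) * x)); first by rewrite mul1r.
  apply: cvgD; first exact: cvg_cst.
  by apply: cvgM; [exact: cvg_powR1|exact: cvg_cst].
Unshelve. all: by end_near. Qed.

(** The factor q^t of the recurrence tends to 1. The filter is arbitrary so as to cover both the
    full left neighbourhood of 1 and its restriction to the [q] where [K] is defined. *)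
Lemma K_cvg1_shift (F : set_system R) {FF : Filter F} x t :
  F --> (1 : R) -> (\forall q \near F, 0 < q < 1) ->
  (\forall q \near F, K_defined q x t%:C) ->
  K q x t%:C @[q --> F] --> (1 : R[i]^o) <->
  K q x (t + 1)%:C @[q --> F] --> (1 : R[i]^o).
Proof.
move=> F1 F01 Fd.
have tE : (t + 1)%:C = t%:C + 1 by rewrite rmorphD.
have sh s : (fun q => (q `^ s)%:C : R[i]^o) @ F --> (1 : R[i]^o).
  by apply: cvg_real_complex; exact: cvg_powR1.
split=> K1.
  apply: (@cvg_trans _ ((fun q => (q `^ t)%:C * K q x t%:C : R[i]^o) @ F)).
    apply: near_eq_cvg; near=> q.
    have q01 : 0 < q < 1 by near: q.
    rewrite tE K_shift //; last by near: q.
    by rewrite cpow_real //; case/andP: q01.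
  by have := cvgM (sh t) K1; rewrite mulr1; apply.
apply: (@cvg_trans _ ((fun q => (q `^ (- t))%:C * K q x (t + 1)%:C : R[i]^o) @ F)).
  apply: near_eq_cvg; near=> q.
  have q01 : 0 < q < 1 by near: q.
  have [q0 _] := andP q01.
  rewrite tE K_shift //; last by near: q.
  rewrite cpow_real // mulrA -(rmorphM (real_complex R)) -gt0_powRD //.
  by rewrite addNr powRr0 mul1r.
by have := cvgM (sh (- t)) K1; rewrite mulr1; apply.
Unshelve. all: by end_near. Qed.

Lemma K_defined_shiftz q x t (n : int) : 0 < q < 1 ->
  K_defined q x (t + n%:~R)%:C <-> K_defined q x t%:C.
Proof.
move=> q01.
have nat_case (m : nat) s : K_defined q x (s + m%:R)%:C <-> K_defined q x s%:C.
  elim: m => [|m IH]; first by rewrite addr0.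
  rewrite -IH -natr1 addrA (rmorphD (real_complex R) _ 1); exact: K_defined_shift.
case: n => m; first exact: nat_case.
by rewrite NegzE mulrNz -(nat_case m.+1 (t - m.+1%:R)) subrK.
Qed.

Lemma K_cvg1_shiftz (F : set_system R) {FF : Filter F} x t (n : int) :
  F --> (1 : R) -> (\forall q \near F, 0 < q < 1) ->
  (\forall q \near F, K_defined q x t%:C) ->
  K q x t%:C @[q --> F] --> (1 : R[i]^o) <->
  K q x (t + n%:~R)%:C @[q --> F] --> (1 : R[i]^o).
Proof.
move=> F1 F01.
have nat_case (m : nat) s : (\forall q \near F, K_defined q x s%:C) ->
    K q x s%:C @[q --> F] --> (1 : R[i]^o) <->
    K q x (s + m%:R)%:C @[q --> F] --> (1 : R[i]^o).
  move=> Fd; elim: m => [|m IH]; first by rewrite addr0.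
  rewrite IH -natr1 addrA; apply: K_cvg1_shift => //.
  near=> q; apply/(K_defined_shiftz _ _ m) => //; first by near: q.
  by near: q.
case: n => m Fd; first exact: nat_case.
have Fd' : \forall q \near F, K_defined q x (t - m.+1%:R)%:C.
  near=> q; rewrite -(K_defined_shiftz x (t - m.+1%:R) m.+1) ?subrK; by near: q.
by rewrite NegzE mulrNz (nat_case m.+1 (t - m.+1%:R)) ?subrK.
Unshelve. all: by end_near. Qed.

Lemma at_left1_itv01 : \forall q \near (1 : R)^'-, 0 < q < 1.
Proof.
near=> q; apply/andP; split; near: q.
  by apply: nbhs_left_gt; exact: ltr01.
by apply: nbhs_left_lt.
Unshelve. all: by end_near. Qed.

Lemma K_cvg1_gt0 x t : 0 < x -> K q x t%:C @[q --> 1^'-] --> (1 : R[i]^o).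
Proof.
move=> x0.
have c1 : (1 : R)^'- --> (1 : R) by exact: cvg_at_left_filter.
have F01 := at_left1_itv01.
have Fd s : \forall q \near (1 : R)^'-, K_defined q x s%:C.
  by near=> q; apply: K_defined_gt0 => //; near: q.
(* The squeeze covers exponents in [0, 1]; the recurrence reduces [t] to its fractional part. *)
have := K_cvg1_shiftz (Num.floor t) c1 F01 (Fd (t - (Num.floor t)%:~R)).
rewrite subrK => <-.
apply: (@cvg_trans _ ((fun q => (rK q x (t - (Num.floor t)%:~R))%:C : R[i]^o) @ 1^'-)).
  by apply: near_eq_cvg; near=> q; rewrite rKE //; near: q.
apply: cvg_real_complex; apply: rK_cvg1 => //.
rewrite subr_ge0 floor_le_tmp /= lerBlDl -[X in _ + X]/(1%:~R) -intrD.
by rewrite ltW // lt_succ_floor.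
Unshelve. all: by end_near. Qed.

(** For negative [x] other than -1, a denominator vanishes whenever - x is an integer power of [q],
    which happens for [q] arbitrarily close to 1; hence the restricted filter. The recurrence
    reduces [n] to 0, where [K] is exactly 1. *)
Lemma K_cvg1_int x (n : int) : x != 0 ->
  K q x n%:~R @[q --> within [set q : R | K_defined q x n%:~R] 1^'-] --> (1 : R[i]^o).
Proof.
move=> x0; set F := within _ _.
have FF : Filter F by exact: within_filter.
have F1 : F --> (1 : R).
  by apply: (@cvg_trans _ (1 : R)^'-); [exact: cvg_within|exact: cvg_at_left_filter].
have F01 : \forall q \near F, 0 < q < 1.
  by apply: cvg_within; exact: at_left1_itv01.
have nE : n%:~R = (0 + n%:~R)%:C :> R[i].
  by rewrite add0r (rmorph_int (real_complex R)).
have F0 : \forall q \near F, K_defined q x 0%:C.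
  near=> q; rewrite -(@K_defined_shiftz q x 0 n) ?nE; last by near: q.
  rewrite -nE; near: q; rewrite /F; exact: withinT.
rewrite nE -(K_cvg1_shiftz n F1 F01 F0).
apply: (@cvg_trans _ ((fun=> 1 : R[i]^o) @ F)); last exact: cvg_cst.
by apply: near_eq_cvg; near=> q; rewrite K0 //; near: q.
Unshelve. all: by end_near. Qed.

(** * The limit as q tends to 0 *)

Lemma rqinfty_cvg1 (F : set_system R) {FF : Filter F} (f : R -> R) :
  F --> (0 : R) -> (\forall q \near F, 0 < q < 1) -> f @ F --> (0 : R) ->
  (fun q => rqinfty q (f q)) @ F --> (1 : R).
Proof.
move=> F0 F01 f0; apply/subr_cvg0; apply: norm_cvg0.
apply: (@squeeze_cvgr _ _ _ _ (fun=> 0)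
  (fun q => expR (`|f q| / (1 - q)) * `|f q| / (1 - q))).
- near=> q; rewrite normr_ge0 /=.
  have q01 : 0 < q < 1 by near: q.
  exact: (rqinfty_spec _ q01).2.
- exact: cvg_cst.
have c1 : (fun q => (1 - q)^-1) @ F --> (1 - 0 : R)^-1.
  apply: cvgV; first by rewrite subr0 oner_neq0.
  by apply: cvgB; [exact: cvg_cst|exact: F0].
have c2 : (fun q => `|f q| / (1 - q)) @ F --> (`|0 : R| / (1 - 0) : R).
  by apply: cvgM; [exact: cvg_norm|exact: c1].
have zero : expR (`|0 : R| / (1 - 0)) * (`|0 : R| / (1 - 0)) = 0.
  by rewrite normr0 mul0r mulr0.
rewrite -[X in _ --> X]zero.
under eq_fun do rewrite -mulrA.
apply: cvgM; last exact: c2.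
by apply: continuous_cvg c2; exact: continuous_expR.
Unshelve. all: by end_near. Qed.

Lemma K_cvg0 (F : set_system R) {FF : Filter F} x t :
  F --> (0 : R) -> (\forall q \near F, 0 < q < 1) ->
  (forall s, 0 < s -> (fun q => q `^ s) @ F --> (0 : R)) ->
  x != 0 -> x != -1 -> 0 < t < 1 ->
  K q x t%:C @[q --> F] --> (cpow x t%:C + cpow x (t%:C - 1) : R[i]^o).
Proof.
move=> F0 F01 Fpow x0 x1 /andP[t0 t1].
(* Once the factor 1 + a is split off P(a), both remaining products have arguments tending to 0. The
   positivity of [s] is needed for [t] and for [1 - t], hence the open interval. *)
have ratio s a : 0 < s ->
    (fun q => rqinfty q a / rqinfty q (q `^ s * a)) @ F --> (1 + a : R).
  move=> s0.
  apply: (@cvg_trans _ ((fun q =>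
      (1 + a) * rqinfty q (q * a) / rqinfty q (q `^ s * a)) @ F)).
    by apply: near_eq_cvg; near=> q; rewrite [rqinfty q a]rqinfty_recl //; near: q.
  have one : (1 + a) * 1 * 1^-1 = 1 + a by rewrite invr1 !mulr1.
  suff: (fun q => (1 + a) * rqinfty q (q * a) / rqinfty q (q `^ s * a)) @ F
      --> (1 + a) * 1 * 1^-1 by rewrite one.
  have small f : f @ F --> (0 : R) -> (fun q => rqinfty q (f q * a)) @ F --> (1 : R).
    move=> f0; apply: rqinfty_cvg1 => //; rewrite -(mul0r a).
    by apply: cvgM => //; exact: cvg_cst.
  apply: cvgM; first by apply: cvgM; [exact: cvg_cst|exact: small].
  by apply: cvgV; [exact: oner_neq0|apply: small; exact: Fpow].
apply: (@cvg_trans _ ((fun q => (1 + x%:C)^-1 * cpow x t%:C *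
  (rqinfty q x^-1 / rqinfty q (q `^ t * x^-1))%:C *
  (rqinfty q x / rqinfty q (q `^ (1 - t) * x))%:C : R[i]^o) @ F)).
  by apply: near_eq_cvg; near=> q; rewrite K_realE //; near: q.
have X0 : x%:C != 0 by rewrite (fmorph_eq0 (real_complex R)).
have X1 : 1 + x%:C != 0.
  by rewrite -(rmorphD (real_complex R) 1) (fmorph_eq0 (real_complex R)) addrC addr_eq0.
have -> : cpow x t%:C + cpow x (t%:C - 1) =
    (1 + x%:C)^-1 * cpow x t%:C * (1 + x^-1)%:C * (1 + x)%:C.
  rewrite cpowB cpow1 // !(rmorphD (real_complex R)) (fmorphV (real_complex R)).
  by field; rewrite X0 X1.
apply: (@cvgM _ _ _ _ (fun q => _ : R[i]^o) (fun q => _ : R[i]^o)).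
  apply: (@cvgM _ _ _ _ (fun q => _ : R[i]^o) (fun q => _ : R[i]^o)).
    exact: cvg_cst.
  by apply: cvg_real_complex; exact: ratio.
by apply: cvg_real_complex; apply: ratio; rewrite subr_gt0.
Unshelve. all: by end_near. Qed.

Lemma K_cvg0_right x t : x != 0 -> x != -1 -> 0 < t < 1 ->
  K q x t%:C @[q --> 0^'+] --> (cpow x t%:C + cpow x (t%:C - 1) : R[i]^o).
Proof.
apply: K_cvg0.
- exact: cvg_at_right_filter.
- near=> q; apply/andP; split; near: q.
    exact: nbhs_right_gt.
  by apply: nbhs_right_lt; exact: ltr01.
- by move=> s s0; exact: powR_cvg0.
Unshelve. all: by end_near. Qed.

End KLimits.

(** * Sums over the integers *)

Section BilateralSums.
Variable R : realType.
Implicit Types (a c : R) (f g : int -> R).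

Lemma esumZl (T : choiceType) (D : set T) (f : T -> \bar R) (c : R) :
  0 < c -> (forall i, (0 <= f i)%E) ->
  (\esum_(i in D) (c%:E * f i) = c%:E * \esum_(i in D) f i)%E.
Proof.
have le (b : R) (g : T -> \bar R) : 0 < b -> (forall i, (0 <= g i)%E) ->
    (\esum_(i in D) (b%:E * g i) <= b%:E * \esum_(i in D) g i)%E.
  move=> b0 g0; apply: ge_ereal_sup => _ [A [finA AD] <-].
  rewrite -ge0_mule_fsumr //; apply: lee_wpmul2l; first by rewrite lee_fin ltW.
  by apply: ereal_sup_ubound; exists A.
move=> c0 f0; apply/eqP; rewrite eq_le le //=.
have cf0 i : (0 <= c%:E * f i)%E by rewrite mule_ge0 // lee_fin ltW.
(* The reverse inequality is the same one for the constant [c^-1]. *)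
have := le c^-1 _ _ cf0; rewrite invr_gt0 => /(_ c0).
under eq_esum do rewrite muleA -EFinM mulVf ?gt_eqF // mul1e.
by rewrite lee_pdivlMl.
Qed.

(** Extended real values allow nonnegative sums to be rearranged before they are known to be
    finite. *)
Definition zsum f : \bar R := (\esum_(n in [set: int]) (f n)%:E)%E.

Lemma zsum_ge0 f : (forall n, 0 <= f n) -> (0 <= zsum f)%E.
Proof. by move=> f0; apply: esum_ge0 => n _; rewrite lee_fin. Qed.

Lemma eq_zsum f g : f =1 g -> zsum f = zsum g.
Proof. by move=> fg; apply: eq_esum => n _; rewrite fg. Qed.

Lemma le_zsum f g : (forall n, f n <= g n) -> (zsum f <= zsum g)%E.
Proof. by move=> fg; apply: le_esum => n _; rewrite lee_fin. Qed.

Lemma zsum_term f n : (forall n, 0 <= f n) -> ((f n)%:E <= zsum f)%E.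
Proof.
move=> f0; apply: esum_ge; exists [set n]; last by rewrite fsbig_set1.
by split => //; exact: finite_set1.
Qed.

Lemma zsum_shift (k : int) f : zsum (fun n => f (n + k)) = zsum f.
Proof.
rewrite /zsum [RHS](reindex_esum [set: int] _ (fun n => n + k)) //.
split=> [//|x y _ _ /addIr //|y _].
by exists (y - k) => //; rewrite subrK.
Qed.

Lemma zsum_opp f : zsum (fun n => f (- n)) = zsum f.
Proof.
by rewrite /zsum [RHS](reindex_esum [set: int] _ (fun n => - n)).
Qed.

Lemma zsumD f g : (forall n, 0 <= f n) -> (forall n, 0 <= g n) ->
  zsum (fun n => f n + g n) = (zsum f + zsum g)%E.
Proof.
move=> f0 g0; rewrite /zsum; under eq_esum do rewrite EFinD.
by rewrite esumD // => n _; rewrite lee_fin.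
Qed.

Lemma zsumZ c f : 0 < c -> (forall n, 0 <= f n) ->
  zsum (fun n => c * f n) = (c%:E * zsum f)%E.
Proof.
move=> c0 f0; rewrite /zsum; under eq_esum do rewrite EFinM.
by rewrite esumZl // => n; rewrite lee_fin.
Qed.

Lemma zsumM f g : (forall n, 0 <= f n) -> (forall n, 0 < g n) ->
  (zsum g < +oo)%E -> (zsum f * zsum g =
    \esum_(p in [set: int * int]) (f p.1 * g p.2)%:E)%E.
Proof.
move=> f0 g0 goo.
have g0' n : 0 <= g n by exact: ltW.
have gfin : zsum g \is a fin_num by rewrite ge0_fin_numE // zsum_ge0.
have zg0 : 0 < fine (zsum g).
  by rewrite -lte_fin fineK // (lt_le_trans _ (zsum_term 0 g0')) // lte_fin.
rewrite -(fineK gfin) muleC -esumZl //.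
rewrite (_ : [set: int * int] = [set: int] `*`` (fun=> [set: int])); last first.
  by apply/seteqP; split.
rewrite -(@esum_esum R int int [set: int] (fun=> [set: int])
  (fun n m => (f n * g m)%:E)); last first.
  by move=> n m _ _; rewrite lee_fin mulr_ge0.
apply: eq_esum => n _; rewrite fineK // muleC.
(* [esumZl] requires a positive constant, so a vanishing [f n] is treated apart. *)
have := f0 n; rewrite le_eqVlt => /predU1P[<-|fn0].
  by rewrite mul0e esum1 // => m _; rewrite mul0r.
by under [RHS]eq_esum do rewrite EFinM; rewrite esumZl // => m; rewrite lee_fin.
Qed.

(** The two sums run over the pairs whose entries have equal, respectively opposite, parity. *)
Lemma zsum_parity (f : int * int -> R) : (forall p, 0 <= f p) ->
  (\esum_(p in [set: int * int]) (f p)%:E =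
   \esum_(p in [set: int * int]) (f (p.1 + p.2, p.1 - p.2))%:E +
   \esum_(p in [set: int * int]) (f (p.1 + p.2 + 1, p.1 - p.2))%:E)%E.
Proof.
move=> f0; pose e0 (p : int * int) := (p.1 + p.2, p.1 - p.2).
pose e1 (p : int * int) := (p.1 + p.2 + 1, p.1 - p.2).
rewrite (esumID (range e0)); last by move=> p _; rewrite lee_fin.
rewrite !setTI (_ : ~` range e0 = range e1).
  rewrite !esum_image //.
    by move=> [a b] [c d] _ _ [/= h1 h2]; congr pair; lia.
  by move=> [a b] [c d] _ _ [/= h1 h2]; congr pair; lia.
apply/seteqP; split=> [[n m] /= nm|_ [[a b] _ <-] [[c d] _ [/= h1 h2]]]; last by lia.
have [[k E]|[k E]] : (exists k, n - m = k + k) \/ (exists k, n - m = k + k + 1).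
- have := divz_eq (n - m) 2; have := ltz_pmod (n - m) (isT : 0 < 2%:Z).
  have := modz_ge0 (n - m) (isT : 2%:Z != 0).
  move: (modz _ _) (divz _ _) => r k r0 r2 E.
  have [r1|r1] : r = 0 \/ r = 1 by lia.
    by left; exists k; lia.
  by right; exists k; lia.
- by exfalso; apply: nm; exists (n - k, k) => //; congr pair => /=; lia.
- by exists (n - k - 1, k) => //; congr pair => /=; lia.
Qed.

End BilateralSums.

(** * Euler's expansion of the infinite product *)

Section JacobiTripleProduct.
Variable R : realType.
Variable d : R.
Hypothesis d0 : 0 < d.
Implicit Types (a u v : R) (n m k : int).

Let q := expR (- d).

Let q01 : 0 < q < 1.
Proof. by rewrite expR_gt0 expR_lt1 oppr_lt0. Qed.

(* Coefficient of [x ^ n] in Euler's expansion of [(1 + x)_q^oo], for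
   [q = e ^ (- d)]; defining it on all integers makes the recurrence uniform. *)
Definition euler_coef n : R :=
  if n is Posz m then \prod_(j < m) (expR (- d * j%:R) / (1 - expR (- d * j.+1%:R)))
  else 0.

Lemma expRNd_lt1 (m : nat) : (0 < m)%N -> expR (- d * m%:R) < 1.
Proof. by move=> m0; rewrite expR_lt1 mulNr oppr_lt0 mulr_gt0 // ltr0n. Qed.

Lemma euler_coef_ge0 n : 0 <= euler_coef n.
Proof.
case: n => //= m; apply: prodr_ge0 => j _.
by rewrite divr_ge0 ?expR_ge0 // subr_ge0 ltW // expRNd_lt1.
Qed.

Lemma euler_coef0 : euler_coef 0 = 1.
Proof. exact: big_ord0. Qed.

(** Comparison of coefficients in P(x) = (1 + x) P(q x), stated without subtraction or division. *)
Lemma euler_coefE n : euler_coef n = expR (- d * n%:~R) * euler_coef n +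
  expR (- d * (n - 1)%:~R) * euler_coef (n - 1).
Proof.
case: n => [[|m]|m]; last by rewrite /= !mulr0 addr0.
  by rewrite euler_coef0 /= mulr0 expR0 mulr1 mulr0 addr0.
have -> : m.+1%:Z - 1 = m by lia.
rewrite /= big_ord_recr /= -!pmulrn.
have := expRNd_lt1 (ltn0Sn m); rewrite -subr_gt0 => /gt_eqF/negbT.
by move: (expR (- d * m.+1%:R)) => y y0; field.
Qed.

(** Euler's series in the variable x = e^u; replacing x by q x subtracts [d] from [u]. *)
Definition euler u : \bar R := zsum (fun n => euler_coef n * expR (n%:~R * u)).

Lemma euler_term_ge0 u n : 0 <= euler_coef n * expR (n%:~R * u).
Proof. by rewrite mulr_ge0 ?expR_ge0 // euler_coef_ge0. Qed.

Lemma euler_rec u : euler u = ((1 + expR u)%:E * euler (u - d))%E.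
Proof.
rewrite EFinD ge0_muleDl ?lee_fin ?expR_ge0 // mul1e.
rewrite -zsumZ ?expR_gt0 //; last exact: euler_term_ge0.
rewrite -[X in (_ + X)%E](zsum_shift (- 1)) -zsumD; last 2 first.
- exact: euler_term_ge0.
- by move=> n; rewrite mulr_ge0 ?expR_ge0 // euler_term_ge0.
apply: eq_zsum => n; rewrite [X in X * _ = _]euler_coefE mulrDl; congr (_ + _).
  by rewrite mulrAC -expRD mulrC; congr (_ * expR _); ring.
rewrite mulrAC -expRD mulrCA -expRD mulrC; congr (_ * expR _).
by rewrite intrD; ring.
Qed.

Lemma euler_iter u (N : nat) : euler u =
  ((\prod_(j < N) (1 + q ^+ j * expR u))%:E * euler (u - d *+ N))%E.
Proof.
elim: N => [|N IH]; first by rewrite big_ord0 mul1e subr0.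
rewrite IH big_ord_recr /= euler_rec muleA -EFinM mulrSr opprD addrA.
by congr ((_ * (1 + _))%:E * _)%E; rewrite /q -expRM_natl -expRD mulrN mulr_natl addrC.
Qed.

Lemma euler_ge1 u : (1 <= euler u)%E.
Proof.
apply: le_trans (zsum_term 0 (euler_term_ge0 u)).
by rewrite euler_coef0 mul0r expR0 mulr1.
Qed.

(** The constant term is 1, and every later term shrinks at least by the factor [expR (v - u)]. This
    forces [euler (u - d *+ N)] to tend to 1. *)
Lemma euler_le u v : v <= u ->
  (euler v <= 1 + (expR (v - u))%:E * euler u)%E.
Proof.
move=> vu; have c0 : 0 <= expR (v - u) by exact: expR_ge0.
have one : zsum (fun n => (n == 0)%:R) = 1%E :> \bar R.
  rewrite /zsum -(@esum_set1 R int 0 (fun=> 1%E)) //.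
  rewrite [RHS]esum_mkcond; apply: eq_esum => n _.
  by case: eqVneq => [->|/eqP n0]; [rewrite mem_set|rewrite memNset].
rewrite -one -zsumZ ?expR_gt0 //; last exact: euler_term_ge0.
rewrite -zsumD //; last by move=> n; rewrite mulr_ge0 ?euler_term_ge0.
apply: le_zsum => -[[|m]|m].
- by rewrite euler_coef0 !mul0r expR0 !mulr1 lerDl.
- rewrite add0r mulrCA ler_wpM2l ?euler_coef_ge0 // -expRD ler_expR.
  rewrite -subr_ge0 [X in 0 <= X](_ : _ = m%:R * (u - v)); last first.
    by rewrite -!pmulrn -natr1; ring.
  by rewrite mulr_ge0 // subr_ge0.
- by rewrite /= !mul0r mulr0 addr0.
Qed.

(** The series converges for small x by comparison with a geometric one; the functional equation
    extends this to all x. *)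
Lemma euler_lty u : (euler u < +oo)%E.
Proof.
have [q0 q1] := andP q01; have q1' : 0 < 1 - q by rewrite subr_gt0.
have coef_le (m : nat) : euler_coef m <= (1 - q) ^- m.
  elim: m => [|m IH]; first by rewrite euler_coef0 expr0 invr1.
  rewrite /= big_ord_recr /= exprSr invfM ler_pM ?(euler_coef_ge0 m) //.
    by rewrite divr_ge0 ?expR_ge0 // subr_ge0 ltW // expRNd_lt1.
  have jlt := expRNd_lt1 (ltn0Sn m); rewrite -[leRHS]mul1r.
  apply: ler_pM; rewrite ?expR_ge0 ?invr_ge0 ?subr_ge0 ?(ltW jlt) //.
    by rewrite -expR0 ler_expR mulNr oppr_le0 mulr_ge0 // ltW.
  rewrite lef_pV2 ?posrE ?subr_gt0 // lerD2l lerN2 ler_expR.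
  by rewrite mulNr lerN2 ler_peMr ?(ltW d0) // ler1n.
(* As the coefficients are at most (1 - q)^(-m), the terms at [u0] are at most 2^(-m). *)
pose u0 := ln ((1 - q) / 2).
have fin0 : (euler u0 < +oo)%E.
  rewrite /euler /zsum (esumID (range Posz)); last first.
    by move=> n _; rewrite lee_fin euler_term_ge0.
  rewrite !setTI [X in (_ + X)%E]esum1 ?adde0; last first.
    by move=> [m|m] // nP; [exfalso; apply: nP; exists m|rewrite /= mul0r].
  rewrite esum_image; last by move=> x y _ _ [].
  rewrite -nneseries_esumT; last by move=> m; rewrite lee_fin euler_term_ge0.
  have geo := @cvg_geometric_eseries_half R 2 0.
  apply: (@le_lt_trans _ _ (\sum_(0 <= k <oo) (2 / (2 ^ (k + 1))%:R)%:E)%E).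
    apply: lee_nneseries => m _; rewrite lee_fin ?euler_term_ge0 //.
    rewrite -pmulrn expRM_natl lnK ?posrE ?divr_gt0 //.
    rewrite addn1 expnS natrM invfM mulrA mulfV // mul1r natrX.
    rewrite expr_div_n mulrA -[leRHS]mul1r ler_wpM2r ?invr_ge0 ?exprn_ge0 //.
    by rewrite -ler_pdivlMr ?exprn_gt0 // div1r coef_le.
  by rewrite (cvg_lim _ geo) // ltry.
have [N uN] : exists N, u - d *+ N <= u0.
  exists (Num.truncn ((u - u0) / d)).+1.
  rewrite lerBlDl -lerBlDr -mulr_natr mulrC -ler_pdivrMr //.
  by rewrite ltW // truncnS_gt.
rewrite (euler_iter u N) lte_mul_pinfty ?lee_fin //.
  by apply: prodr_ge0 => j _; rewrite addr_ge0 ?mulr_ge0 ?exprn_ge0 ?expR_ge0 //.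
apply: le_lt_trans (euler_le uN) _.
by rewrite lte_add_pinfty ?ltry // lte_mul_pinfty ?lee_fin ?expR_ge0.
Qed.

(** Iterating the functional equation writes the series as a partial product times a remainder
    [euler (u - d *+ N)], which tends to 1. *)
Lemma eulerE u : euler u = (rqinfty q (expR u))%:E.
Proof.
have finE v : euler v = (fine (euler v))%:E.
  by rewrite fineK // ge0_fin_numE ?euler_lty // (le_trans _ (euler_ge1 v)).
have p1 : (fun N : nat => fine (euler (u - d *+ N))) @ \oo --> (1 : R).
  apply: (@squeeze_cvgr _ _ _ _ (fun=> 1)
     (fun N => 1 + q ^+ N * fine (euler u))); last 2 first.
  - exact: cvg_cst.
  - rewrite -[X in _ --> X](addr0 1) -(mul0r (fine (euler u))).
    apply: cvgD; first exact: cvg_cst.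
    apply: cvgM; last exact: cvg_cst.
    by apply: cvg_expr; rewrite gtr0_norm; case/andP: q01.
  apply: nearW => N; apply/andP; split.
    by rewrite -lee_fin -finE euler_ge1.
  rewrite -lee_fin -finE EFinD EFinM -finE.
  have := @euler_le u (u - d *+ N).
  rewrite lerBlDr lerDl mulrn_wge0 ?(ltW d0) // => /(_ isT).
  by rewrite addrAC subrr add0r -mulNrn -mulr_natl expRM_natl.
have p2 := (rqinfty_spec (expR u) q01).1.
rewrite finE; congr EFin.
have p3 : (fun N : nat => fine (euler u)) @ \oo --> rqinfty q (expR u) * 1.
  rewrite (_ : (fun=> _) = (fun N : nat => \prod_(j < N) (1 + q ^+ j * expR u) *
     fine (euler (u - d *+ N)))); last first.
    apply/funext => N; apply: EFin_inj.
    by rewrite EFinM -!finE -euler_iter.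
  by apply: cvgM.
have := @cvg_unique _ _ _ _ _ _ p3 (@cvg_cst _ (fine (euler u)) _ _ _).
by rewrite mulr1 => ->.
Qed.

End JacobiTripleProduct.

(** * The triple product and Gaussian sums *)

Section Theta.
Variable R : realType.
Implicit Types (h d s u v p : R) (n m k : int).

(** Coefficient of x^k in P(x) P(q / x), where q = e^(-d). *)
Definition triple_coef d k : \bar R :=
  zsum (fun m => euler_coef d (k + m) * (euler_coef d m * expR (- d * m%:~R))).

(** Expanding the first Euler coefficient on the left and the second on the right by [euler_coefE]
    gives the same two sums, up to a shift of the index. *)
Lemma triple_coefS d k : 0 < d ->
  triple_coef d (k + 1) = ((expR (- d * k%:~R))%:E * triple_coef d k)%E.
Proof.
move=> d0; have e0 := euler_coef_ge0 d0.
pose A m := expR (- d * (k + 1 + m + m)%:~R) *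
  (euler_coef d (k + 1 + m) * euler_coef d m).
pose B m := expR (- d * (k + m + m)%:~R) *
  (euler_coef d (k + m) * euler_coef d m).
have A0 m : 0 <= A m by rewrite mulr_ge0 ?expR_ge0 // mulr_ge0.
have B0 m : 0 <= B m by rewrite mulr_ge0 ?expR_ge0 // mulr_ge0.
have lhs : triple_coef d (k + 1) = (zsum A + zsum B)%E.
  rewrite -zsumD //; apply: eq_zsum => m; rewrite [X in X * _ = _](euler_coefE d0).
  have -> : k + 1 + m - 1 = k + m by ring.
  have -> : A m = expR (- d * (k + 1 + m)%:~R) * euler_coef d (k + 1 + m) *
      (euler_coef d m * expR (- d * m%:~R)).
    by rewrite /A (intrD _ (k + 1 + m)) mulrDr expRD; ring.
  have -> : B m = expR (- d * (k + m)%:~R) * euler_coef d (k + m) *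
      (euler_coef d m * expR (- d * m%:~R)).
    by rewrite /B (intrD _ (k + m)) mulrDr expRD; ring.
  ring.
rewrite lhs -zsumZ ?expR_gt0 //; last first.
  by move=> m; rewrite !mulr_ge0 ?expR_ge0.
rewrite -(zsum_shift (-1) A) addeC -zsumD //; apply: eq_zsum => m.
rewrite [X in _ * (_ * (X * _))](euler_coefE d0) /A.
have -> : k + 1 + (m + -1) = k + m by ring.
have -> : B m = expR (- d * k%:~R) * (euler_coef d (k + m) *
    (expR (- d * m%:~R) * euler_coef d m * expR (- d * m%:~R))).
  by rewrite /B !intrD !mulrDr !expRD; ring.
rewrite !intrD !mulrDr !expRD; ring.
Qed.

Lemma triple_coefE d k : 0 < d ->
  triple_coef d k =
    ((expR (- (d / 2) * (k%:~R ^+ 2 - k%:~R)))%:E * triple_coef d 0)%E.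
Proof.
move=> d0.
have step n : triple_coef d n =
      ((expR (- (d / 2) * (n%:~R ^+ 2 - n%:~R)))%:E * triple_coef d 0)%E <->
    triple_coef d (n + 1) = ((expR (- (d / 2) *
      ((n + 1)%:~R ^+ 2 - (n + 1)%:~R)))%:E * triple_coef d 0)%E.
  rewrite triple_coefS //.
  have -> : expR (- (d / 2) * ((n + 1)%:~R ^+ 2 - (n + 1)%:~R)) =
      expR (- d * n%:~R) * expR (- (d / 2) * (n%:~R ^+ 2 - n%:~R)).
    by rewrite -expRD; congr expR; rewrite intrD; field.
  rewrite EFinM -muleA; split=> [->//|].
  move/(congr1 (fun y => (expR (- - d * n%:~R))%:E * y)%E).
  by rewrite !muleA -!EFinM -!expRD mulNr addNr add0r expR0 mul1e.
have base : triple_coef d 0 =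
    ((expR (- (d / 2) * ((0 : int)%:~R ^+ 2 - (0 : int)%:~R)))%:E * triple_coef d 0)%E.
  by rewrite mulr0z expr0n subrr mulr0 expR0 mul1e.
case: k => m.
  elim: m => [//|m IH].
  by rewrite (_ : m.+1%:Z = m%:Z + 1); [exact: (step m).1 IH|lia].
rewrite NegzE; elim: m => [|m IH]; first by apply: (step _).2; rewrite addNr.
by apply: (step _).2; rewrite (_ : - m.+2%:Z + 1 = - m.+1%:Z) //; lia.
Qed.

Definition gauss_sum h v : \bar R := zsum (fun n => expR (- h * (n%:~R - v) ^+ 2)).

(** With q = e^(-2h) and x = e^(h (2v - 1)), completing the square turns q^(k(k-1)/2) x^k into e^(h
    v^2) e^(-h (k - v)^2). The constant [c] is not evaluated, as it cancels in [K]. *)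
Lemma jacobi_triple h : 0 < h -> exists2 c : R, 0 < c & forall v,
  (rqinfty (expR (- (h *+ 2))) (expR (h * (2 * v - 1))) *
    rqinfty (expR (- (h *+ 2))) (expR (- h * (2 * v + 1))))%:E =
  ((c * expR (h * v ^+ 2))%:E * gauss_sum h v)%E.
Proof.
move=> h0; pose d := h *+ 2; have d0 : 0 < d by rewrite pmulrn_rgt0.
have e0 := euler_coef_ge0 d0.
have prodE u : (euler d u * euler d (- d - u) =
    \esum_(k in [set: int]) ((expR (k%:~R * u))%:E * triple_coef d k))%E.
  have fin w : euler d w \is a fin_num.
    by rewrite ge0_fin_numE ?euler_lty // (le_trans _ (euler_ge1 d0 w)).
  have pos w : 0 < fine (euler d w).
    by rewrite -lte_fin fineK // (lt_le_trans _ (euler_ge1 d0 w)).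
  rewrite -(fineK (fin (- d - u))) muleC -zsumZ //; last exact: euler_term_ge0.
  under eq_zsum do rewrite mulrC.
  transitivity (\esum_(n in [set: int]) \esum_(m in [set: int])
      (euler_coef d n * expR (n%:~R * u) *
       (euler_coef d m * expR (m%:~R * (- d - u))))%:E)%E.
    apply: eq_esum => n _.
    have t0 := euler_term_ge0 d0 u n.
    rewrite EFinM fineK //; move: t0; rewrite le_eqVlt => /predU1P[<-|t0].
      by rewrite mul0e esum1 // => m _; rewrite mul0r.
    by rewrite -zsumZ //; exact: euler_term_ge0.
  rewrite esum_esum; last first.
    by move=> n m _ _; rewrite lee_fin mulr_ge0 ?euler_term_ge0.
  rewrite (reindex_esum [set: int * int] _
    (fun i : int * int => (i.1 + i.2, i.2))); last first.
    split=> [//|[a b] [a' b'] _ _ [/= + bb]|[a b] _].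
      by rewrite bb => /addIr ->.
    by exists (a - b, b) => //=; rewrite subrK.
  rewrite (_ : [set: int * int] = [set: int] `*`` (fun=> [set: int])); last first.
    by apply/seteqP; split.
  rewrite -(@esum_esum R int int [set: int] (fun=> [set: int]) (fun k m =>
    (euler_coef d (k + m) * expR ((k + m)%:~R * u) *
       (euler_coef d m * expR (m%:~R * (- d - u))))%:E)); last first.
    by move=> k m _ _; rewrite lee_fin !mulr_ge0 ?expR_ge0.
  apply: eq_esum => k _; rewrite -zsumZ ?expR_gt0 //; last first.
    by move=> m; rewrite !mulr_ge0 ?expR_ge0.
  apply: eq_zsum => m.
  have -> : expR ((k + m)%:~R * u) = expR (k%:~R * u) * expR (m%:~R * u).
    by rewrite -expRD intrD mulrDl.
  have -> : expR (m%:~R * (- d - u)) = expR (- d * m%:~R) * (expR (m%:~R * u))^-1.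
    by rewrite -expRN -expRD; congr expR; ring.
  by field; rewrite gt_eqF ?expR_gt0.
have c_ge1 : (1 <= triple_coef d 0)%E.
  apply: le_trans (zsum_term 0 _); last by move=> m; rewrite !mulr_ge0 ?expR_ge0.
  by rewrite addr0 euler_coef0 mulr0 expR0 !mulr1.
have c_lty : (triple_coef d 0 < +oo)%E.
  (* At [u = 0] the coefficient is a single term of a finite sum of nonnegative terms. *)
  apply: (@le_lt_trans _ _ (euler d 0 * euler d (- d - 0))%E).
    rewrite prodE; apply: esum_ge; exists [set 0]; last first.
      by rewrite fsbig_set1 mul0r expR0 mul1e.
    by split => //; exact: finite_set1.
  by rewrite !eulerE // ltry.
have cE : triple_coef d 0 = (fine (triple_coef d 0))%:E.
  by rewrite fineK // ge0_fin_numE // (le_trans _ c_ge1).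
exists (fine (triple_coef d 0)) => [|v].
  by rewrite -lte_fin -cE (lt_le_trans _ c_ge1).
have -> : - h * (2 * v + 1) = - d - h * (2 * v - 1) by rewrite /d; ring.
have cpos : 0 < fine (triple_coef d 0) by rewrite -lte_fin -cE (lt_le_trans _ c_ge1).
rewrite EFinM -!eulerE // prodE /gauss_sum -zsumZ ?mulr_gt0 ?expR_gt0 //.
apply: eq_esum => k _; rewrite triple_coefE // cE -!EFinM mulrA mulrC.
rewrite -mulrA -!expRD.
by congr (_ * expR _)%:E; rewrite /d; field.
Qed.

(** The triple product equates a positive multiple of the sum with a real number. *)
Lemma gauss_sum_fin_num h v : 0 < h -> gauss_sum h v \is a fin_num.
Proof.
move=> h0; have [c c0 /(_ v) E] := jacobi_triple h0.
have w0 : (0 <= gauss_sum h v)%E by apply: zsum_ge0 => n; exact: expR_ge0.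
rewrite ge0_fin_numE // ltey; apply/eqP => woo; move: E.
by rewrite woo gt0_muley // lte_fin mulr_gt0 ?expR_gt0.
Qed.

Definition W h v : R := fine (gauss_sum h v).

Lemma WE h v : 0 < h -> (W h v)%:E = gauss_sum h v.
Proof. by move=> h0; rewrite fineK // gauss_sum_fin_num. Qed.

Lemma W_term h v n : 0 < h -> expR (- h * (n%:~R - v) ^+ 2) <= W h v.
Proof.
move=> h0; rewrite -lee_fin WE //.
by apply: zsum_term => m; exact: expR_ge0.
Qed.

Lemma W_gt0 h v : 0 < h -> 0 < W h v.
Proof. by move=> h0; apply: lt_le_trans (W_term v 0 h0); exact: expR_gt0. Qed.

Lemma WN h v : W h (- v) = W h v.
Proof.
congr fine; rewrite /gauss_sum -(zsum_opp (fun n => expR (- h * (n%:~R - v) ^+ 2))).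
by apply: eq_zsum => n; congr expR; rewrite rmorphN; ring.
Qed.

Lemma WB1 h v : W h (v - 1) = W h v.
Proof.
congr fine; rewrite /gauss_sum.
rewrite -(zsum_shift (- 1) (fun n => expR (- h * (n%:~R - (v - 1)) ^+ 2))).
by apply: eq_zsum => n; congr expR; rewrite intrD; ring.
Qed.

(* Rotation by 45 degrees: the lattice of the pairs [(n + m, n - m)] is the
   union of two cosets of [(2 Z)^2]. *)
Lemma W_duplication h p v : 0 < h -> W h (p + v) * W h (p - v) =
  W (h *+ 2) p * W (h *+ 2) v + W (h *+ 2) (p - 1 / 2) * W (h *+ 2) (v - 1 / 2).
Proof.
move=> h0; have h20 : 0 < h *+ 2 by rewrite pmulrn_rgt0.
have lty b w : 0 < b -> (gauss_sum b w < +oo)%E.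
  by move=> b0; rewrite -WE // ltry.
apply: EFin_inj; rewrite EFinD !EFinM !WE // /gauss_sum.
rewrite !zsumM ?lty //; try by move=> n; exact: expR_gt0.
rewrite (zsum_parity (f := fun x => expR (- h * (x.1%:~R - (p + v)) ^+ 2) *
  expR (- h * (x.2%:~R - (p - v)) ^+ 2))); last by move=> x; rewrite mulr_ge0 ?expR_ge0.
(* On the first coset, (a + b - p - v)^2 + (a - b - p + v)^2 = 2 (a - p)^2 + 2 (b - v)^2; on the
   second, [p] and [v] are lowered by 1/2. *)
congr (_ + _)%E; apply: eq_esum => -[a b] _ /=; rewrite -!expRD; congr (expR _)%:E.
  by rewrite !(intrD, rmorphN) /=; ring.
by rewrite !(intrD, rmorphN) /=; field.
Qed.

End Theta.

(** * Non-constancy *)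

Section NonConstant.
Variable R : realType.
Implicit Types (h d s v p r : R).

(** The left side of the duplication formula is unchanged when [p] becomes [p - s], which gives a
    linear relation between [D p] and [D (p - 1 / 2)]. The same relation at [v - 1 / 2] eliminates
    the latter, since [W2] has period 1. *)
Lemma W_half_or_period h s : 0 < h -> (forall v, W h (v - s) = W h v) ->
  (forall v, W (h *+ 2) (v - s) = W (h *+ 2) v) \/
  (forall v, W (h *+ 2) (v - 1 / 2) = W (h *+ 2) v).
Proof.
move=> h0 per; have h20 : 0 < h *+ 2 by rewrite pmulrn_rgt0.
set W2 := W (h *+ 2); pose D p := W2 p - W2 (p - s).
have Dv p v : D p * W2 v + D (p - 1 / 2) * W2 (v - 1 / 2) = 0.
  have := W_duplication p v h0; have := W_duplication (p - s) v h0.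
  rewrite addrAC per [p - s - v]addrAC per [p - s - 1 / 2]addrAC => -> /eqP.
  by rewrite -subr_eq0 => /eqP E; rewrite /D -[RHS]oppr0 -E /W2; ring.
have DD p v : D p * (W2 v ^+ 2 - W2 (v - 1 / 2) ^+ 2) = 0.
  have e1 := Dv p v; have := Dv p (v - 1 / 2).
  rewrite (_ : v - 1 / 2 - 1 / 2 = v - 1); last by field.
  rewrite [W2 (v - 1)]WB1 -/W2 => e2.
  transitivity (W2 v * (D p * W2 v + D (p - 1 / 2) * W2 (v - 1 / 2)) -
    W2 (v - 1 / 2) * (D p * W2 (v - 1 / 2) + D (p - 1 / 2) * W2 v)); first by ring.
  by rewrite e1 e2 !mulr0 subr0.
have [D0|/existsNP[p /eqP Dp]] := pselect (forall p, D p = 0).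
  by left=> v; apply/esym/eqP; rewrite -subr_eq0; apply/eqP/D0.
right=> v; have /eqP := DD p v; rewrite mulf_eq0 (negbTE Dp) /= subr_eq0.
by rewrite eqrXn2 ?(ltW (W_gt0 _ _)) // => /eqP.
Qed.

(** Every integer is at distance at least [b] from [r], so W_h(r) <= e^(-(h - 1) b^2) W_1(r). *)
Lemma W_lt1 r : 0 < r < 1 -> exists h0, forall h, h0 <= h -> 0 < h -> W h r < 1.
Proof.
move=> /andP[r0 r1]; pose b := Num.min r (1 - r).
have b0 : 0 < b by rewrite lt_min r0 subr_gt0.
have nb (n : int) : b ^+ 2 <= (n%:~R - r) ^+ 2.
  rewrite -[leRHS]real_normK ?num_real // lerXn2r ?nnegrE ?(ltW b0) //.
  have [n0|n0] := leP n 0.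
    rewrite distrC ge_min; apply/orP; left; rewrite (le_trans _ (ler_norm _)) // lerDl.
    by rewrite oppr_ge0 lerz0.
  rewrite ge_min; apply/orP; right; rewrite (le_trans _ (ler_norm _)) // lerD2r.
  by rewrite ler1z.
(* This threshold gives (h - 1) b^2 >= W_1(r), and e^y >= 1 + y concludes. *)
exists (1 + W 1 r / b ^+ 2) => h hle h0.
have W1 : 0 < W 1 r by apply: W_gt0.
apply: (@le_lt_trans _ _ (expR (- ((h - 1) * b ^+ 2)) * W 1 r)).
  rewrite -lee_fin EFinM !WE // /gauss_sum -zsumZ ?expR_gt0 //.
  apply: le_zsum => n; rewrite -expRD ler_expR.
  have h1 : 0 <= h - 1.
    by rewrite subr_ge0 (le_trans _ hle) // lerDl divr_ge0 ?exprn_ge0 ?ltW.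
  have := ler_wpM2l h1 (nb n); lra.
rewrite expRN mulrC ltr_pdivrMr ?expR_gt0 // mul1r.
apply: (@lt_le_trans _ _ (1 + (h - 1) * b ^+ 2)); last exact: expR_ge1Dx.
have : W 1 r <= (h - 1) * b ^+ 2.
  by rewrite -ler_pdivrMr ?exprn_gt0 // lerBrDl.
lra.
Qed.

Lemma W_not_periodic h s : 0 < h -> 0 < s < 1 -> ~ (forall v, W h (v - s) = W h v).
Proof.
move=> h0 s01 per.
have [a Wa] := W_lt1 s01.
have [|b Wb] := @W_lt1 (1 / 2); first by apply/andP; split; lra.
have hn0 (n : nat) : 0 < h * 2 ^+ n by rewrite mulr_gt0 // exprn_gt0.
have pern (n : nat) : (forall v, W (h * 2 ^+ n) (v - s) = W (h * 2 ^+ n) v) \/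
    (forall v, W (h * 2 ^+ n) (v - 1 / 2) = W (h * 2 ^+ n) v).
  elim: n => [|n [|] IH]; first by left; rewrite expr0 mulr1.
  - by rewrite exprSr mulrA mulr_natr; exact: W_half_or_period.
  (* Once the period is 1/2, both alternatives of [W_half_or_period] say the same. *)
  - right; rewrite exprSr mulrA mulr_natr.
    by case: (W_half_or_period (hn0 n) IH).
have big (x : R) (n : nat) : x / h <= n%:R -> x <= h * 2 ^+ n.
  move=> xn; rewrite -ler_pdivrMl // mulrC (le_trans xn) //.
  by rewrite -natrX ler_nat ltnW // ltn_expl.
pose n := maxn (Num.truncn (a / h)).+1 (Num.truncn (b / h)).+1.
have na : a <= h * 2 ^+ n.
  apply: big; apply: (le_trans (ltW (truncnS_gt _))).
  by rewrite ler_nat leq_maxl.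
have nb : b <= h * 2 ^+ n.
  apply: big; apply: (le_trans (ltW (truncnS_gt _))).
  by rewrite ler_nat leq_maxr.
have W0 : 1 <= W (h * 2 ^+ n) 0.
  by have := W_term 0 0 (hn0 n); rewrite subr0 expr0n mulr0 expR0.
have no r : W (h * 2 ^+ n) r < 1 ->
    (forall v, W (h * 2 ^+ n) (v - r) = W (h * 2 ^+ n) v) -> False.
  move=> lt1 pr; have := pr 0; rewrite sub0r WN => E.
  by move: lt1; rewrite E ltNge W0.
by case: (pern n); apply: no; [exact: Wa|exact: Wb].
Qed.

(** The denominators form P(y) P(q / y) for y = q^(1-t) x, which is x with [v] replaced by
    [v - (1 - t)]. The triple product applies to them and, after splitting 1 + 1/x off P(1/x), to
    the numerators. *)
Lemma rK_gauss h v t : 0 < h ->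
  rK (expR (- (h *+ 2))) (expR (h * (2 * v - 1))) t =
  expR (h * (t * (1 - t))) * (W h v / W h (v - (1 - t))).
Proof.
move=> h0; set q := expR _; set x := expR _.
have q01 : 0 < q < 1 by rewrite expR_gt0 expR_lt1 oppr_lt0 pmulrn_rgt0.
have [c c0 theta] := jacobi_triple h0.
have thetaE w :
  rqinfty q (expR (h * (2 * w - 1))) * rqinfty q (expR (- h * (2 * w + 1))) =
    c * expR (h * w ^+ 2) * W h w.
  by apply: EFin_inj; rewrite theta [RHS]EFinM WE.
have x0 : 0 < x by exact: expR_gt0.
have qx : q * x^-1 = expR (- h * (2 * v + 1)).
  by rewrite /q /x -expRN -expRD; congr expR; rewrite mulr2n; ring.
have qp r : q `^ r = expR (- (h *+ 2) * r) by rewrite /q expRM.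
set w := v - (1 - t).
have num : rqinfty q x * rqinfty q x^-1 = (1 + x^-1) * (c * expR (h * v ^+ 2) * W h v).
  by rewrite -thetaE [rqinfty q x^-1]rqinfty_recl // qx; ring.
have den : rqinfty q (q `^ (1 - t) * x) * rqinfty q (q `^ t * x^-1) =
    c * expR (h * w ^+ 2) * W h w.
  rewrite -thetaE !qp /x -expRN -!expRD /w.
  by congr (rqinfty q (expR _) * rqinfty q (expR _)); rewrite mulr2n; ring.
have P1 := rqinfty_gt0 q01; have X0 : 0 < 1 + x by rewrite addr_gt0.
have n1 : rqinfty q (q `^ (1 - t) * x) != 0.
  by rewrite gt_eqF // P1 // mulr_ge0 ?powR_ge0 ?ltW.
have n2 : rqinfty q (q `^ t * x^-1) != 0.
  by rewrite gt_eqF // P1 // mulr_ge0 ?powR_ge0 ?invr_ge0 ?ltW.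
transitivity ((1 + x)^-1 * x `^ t * ((rqinfty q x * rqinfty q x^-1) /
  (rqinfty q (q `^ (1 - t) * x) * rqinfty q (q `^ t * x^-1)))).
  by rewrite /rK; field; rewrite n1 n2 gt_eqF.
rewrite num den.
have -> : x `^ t = expR (h * (2 * v - 1) * t) by rewrite /x [RHS]expRM.
have Ww : W h w != 0 by rewrite gt_eqF // W_gt0.
have e1 : expR (h * (t * (1 - t))) = expR (h * (2 * v - 1) * t) * x^-1 *
    expR (h * v ^+ 2) / expR (h * w ^+ 2).
  by rewrite /x -!expRN -!expRD; congr expR; rewrite /w; ring.
have Ew : expR (h * w ^+ 2) != 0 by rewrite gt_eqF ?expR_gt0.
by rewrite e1; field; rewrite Ww Ew !gt_eqF.
Qed.

Lemma K_not_constant q t : 0 < q < 1 -> 0 < t < 1 ->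
  exists x y : R, [/\ 0 < x, 0 < y & K q x t%:C <> K q y t%:C].
Proof.
move=> q01 /andP[t0 t1]; have [q0 q1] := andP q01.
pose h := - ln q / 2; pose s := 1 - t.
have h0 : 0 < h by rewrite divr_gt0 // oppr_gt0 ln_lt0.
have qE : q = expR (- (h *+ 2)).
  by rewrite -mulr_natr divfK ?pnatr_eq0 // opprK lnK ?posrE.
have s01 : 0 < s < 1 by rewrite subr_gt0 t1 gtrBl t0.
have /existsNP[v Wv] := @W_not_periodic h s h0 s01.
(* The second point has parameter [s / 2], where evenness of [W] makes the ratio 1; at the first,
   the ratio differs from 1 by the choice of [v]. *)
exists (expR (h * (2 * v - 1))), (expR (h * (2 * (s / 2) - 1))).
split; rewrite ?expR_gt0 //.
rewrite !rKE ?expR_gt0 // => /complexI; rewrite qE !rK_gauss //.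
move/(mulfI (lt0r_neq0 (expR_gt0 _))); rewrite -/s.
rewrite (_ : s / 2 - s = - (s / 2)); last by field.
rewrite WN divff ?gt_eqF ?W_gt0 // => /divr1_eq.
by move=> /esym.
Qed.
End NonConstant.

Theorem lemma4p1 (R : realType) :
  (* (a) *)
  ((forall x t : R, 0 < x ->
      K q x t%:C @[q --> 1^'-] --> (1 : R[i]^o))
   /\ (forall (x : R) (t : int), x < 0 -> x != -1 ->
      K q x t%:~R @[q --> within [set q : R | K_defined q x t%:~R] 1^'-]
        --> (1 : R[i]^o))
   /\ (forall x t : R, x != 0 -> x != -1 -> 0 < t < 1 ->
      K q x t%:C @[q --> 0^'+] -->
        (cpow x t%:C + cpow x (t%:C - 1) : R[i]^o))
   /\ (forall q t : R, 0 < q < 1 -> 0 < t < 1 ->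
      exists x y : R, [/\ 0 < x, 0 < y & K q x t%:C <> K q y t%:C]))
  /\
  (* (b) *)
  (forall q x : R, 0 < q < 1 ->
     (forall t : R[i], K_defined q x t -> K q x (t + 1) = cpow q t * K q x t)
     /\ (K_defined q x 0 -> K q x 0 = 1)
     /\ (K_defined q x 1 -> K q x 1 = 1)
     /\ (forall n : nat, (0 < n)%N -> K_defined q x n%:R ->
           K q x n%:R = (q ^+ ((n * (n - 1)) %/ 2))%:C))
  /\
  (* (c) *)
  (forall q x t : R, 0 < q < 1 -> K_defined q x t%:C ->
     (K_defined q (q * x) t%:C -> Dq q (fun y => K q y t%:C) x = 0)
     /\ (forall n : int, K_defined q (q ^ n * x) t%:C ->
           K q (q ^ n * x) t%:C = K q x t%:C)).
Proof.
split; [split; [|split; [|split]]|split].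
- by move=> x t; exact: K_cvg1_gt0.
- by move=> x t x0 _; apply: K_cvg1_int; rewrite lt_eqF.
- by move=> x t; exact: K_cvg0_right.
- by move=> q t; exact: K_not_constant.
- move=> q x q01; split; [|split; [|split]].
  + by move=> t; exact: K_shift.
  + exact: K0.
  + by move=> /(@K_nat _ q x 1 q01) ->; rewrite expr0.
  + by move=> n _ /(K_nat q01) ->; rewrite bin2 divn2 subn1.
- move=> q x t q01 dx; split; first by move=> _; exact: Dq_K.
  by move=> n; exact: K_mulXz.
Qed.
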